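(* The height of a knotoid $K$ in $S^2$ is greater than or equal to the $\Lambda$-degree of its arrow polynomial $A[K]$.
   Context: A knotoid diagram in $S^2$ is a generic immersion of $[0,1]$ into the oriented sphere $S^2$ whose only singularities are finitely many transversal double points, each endowed with over/under information (classical crossings). The images of $0$ and $1$ (the tail and the head) are distinct from each other and from the crossings, and the diagram is oriented from tail to head. The $\Omega$-moves are the three Reidemeister moves $\Omega_1,\Omega_2,\Omega_3$ performed inside small disks not containing the endpoints (pulling the strand adjacent to an endpoint over or under another strand is not allowed). Two knotoid diagrams in $S^2$ are equivalent if they are related by a finite sequence of $\Omega$-moves and isotopy of $S^2$; a knotoid in $S^2$ is an equivalence class. Height. A shortcut of a knotoid diagram is an arc embedded in $S^2$ connecting the two endpoints, meeting the diagram otherwise transversally and away from its crossings. The height of a diagram is the minimum, over all shortcuts, of the number of crossings the shortcut makes with the diagram (in its interior). The height $h(K)$ of a knotoid $K$ in $S^2$ is the minimum of the heights of all knotoid diagrams in $S^2$ representing $K$. Arrow polynomial. Smooth every classical crossing of an oriented diagram $K$ in one of two ways, the $A$-smoothing (label $A$) or the $B$-smoothing (label $A^{-1}$) of the Kauffman bracket. At a positive crossing the $A$-smoothing is the oriented one and the $B$-smoothing is disoriented; at a negative crossing the $B$-smoothing is the oriented one and the $A$-smoothing is disoriented. A disoriented smoothing joins the two outgoing half-strands to each other and the two incoming half-strands to each other; each of the two junctions is recorded as a cusp (both arcs go out of it or both go into it), whose inside is the side of the acute angle (the quadrant of the crossing between the two joined half-strands). A state $S$ is a choice of smoothing at every crossing;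 it consists of circular components and one long component containing the two endpoints. Two cusps that are consecutive along a component and have their insides on the same side of the segment connecting them are cancelled; consecutive cusps with insides on opposite sides are not cancelled. State components are also considered up to isotopy of $S^2$ (and the detour move for virtual diagrams). After all cancellations the surviving cusps on a component alternate sides. A circular component with $2i>0$ surviving cusps is assigned the variable $K_i$, the long component with $2i>0$ surviving cusps is assigned the variable $\Lambda_i$, and components without surviving cusps are assigned $1$; all these variables commute with each other and with $A$. The arrow polynomial is $$A[K]=\sum_S A^{i-j}(-A^2-A^{-2})^{\|S\|-1}\langle\hat S\rangle ,$$ where $i$ and $j$ are the numbers of smoothings labelled $A$ and $A^{-1}$ in $S$, $\|S\|$ is the number of components of $S$, and $\langle\hat S\rangle$ is the product of the variables assigned to the components of $S$. An $\Omega_1$-move multiplies $A[K]$ by a factor $-A^{\pm3}$ and the other moves leave it unchanged. The $\Lambda$-degree of a summand $A^m(K_{i_1}^{j_1}\cdots K_{i_n}^{j_n})\Lambda_i$ is $i$ (and $0$ for a summand containing no $\Lambda$-variable). The $\Lambda$-degree of the arrow polynomial is the maximum of the $\Lambda$-degrees of its summands. *)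

(* Defs.v *)
From HB Require Import structures.
From mathcomp Require Import all_boot all_order all_algebra finmap.
From mathcomp.multinomials Require Import monalg.
From Stdlib Require Import Relations ClassicalEpsilon.

Set Implicit Arguments.
Unset Strict Implicit.
Unset Printing Implicit Defensive.

Import GRing.Theory.

(** * Knotoid diagrams in the sphere

  A diagram is recorded by what the immersion of [0,1] meets, in order, from
  tail to head: the list of its passages through the crossings (a signed Gauss
  code).  The code determines the cyclic order of the half-strands around every
  crossing, hence a rotation system of the underlying connected graph; the code
  is that of a diagram in S^2 iff this rotation system has genus 0, and the
  diagram is then determined up to isotopy of the oriented sphere. *)

(** A crossing is a name and a sign ([true] = positive), so that [(n, true)] and
  [(n, false)] are different crossings; a passage is a crossing and a level
  ([true] = along the overpass). *)
Definition crossing : Type := (nat * bool)%type.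
Definition passage : Type := (crossing * bool)%type.
Definition gcode := seq passage.

Definition mate (x : passage) : passage := (x.1, ~~ x.2).

Definition gauss (w : gcode) : bool := uniq w && all (fun x => mate x \in w) w.

Definition crossings (w : gcode) : {fset crossing} :=
  [fset x.1 | x in w]%fset.

Section Plane.
Variable w : gcode.

(** The passages cut the strand into [(size w).+1] edges.  The dart [(e, false)]
  is the initial half of edge [e], and [(e, true)] its final half. *)
Definition dart : finType := ('I_(size w).+1 * bool)%type.

Definition tail_dart : dart := (ord0, false).
Definition head_dart : dart := (ord_max, true).

Definition opp (d : dart) : dart := (d.1, ~~ d.2).

(** The half-strand coming in ([out = false]) or going out ([out = true]) at [x]. *)
Definition dart_at (x : passage) (out : bool) : dart :=
  if out then (inord (index x w).+1, false) else (inord (index x w), true).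

(** The inverse of [dart_at]; [None] at the two endpoints. *)
Definition site (d : dart) : option (passage * bool) :=
  if d.2 then omap (fun x => (x, false)) (onth w d.1)
  else if (d.1 : nat) is i.+1 then omap (fun x => (x, true)) (onth w i)
  else None.

(** The next dart, counterclockwise, at the same vertex.  The counterclockwise
  order is (over-out, under-out, over-in, under-in) at a positive crossing and
  (over-out, under-in, over-in, under-out) at a negative one. *)
Definition ccw (d : dart) : dart :=
  if site d is Some (x, out)
  then dart_at (mate x) (if x.2 == x.1.2 then out else ~~ out)
  else d.

(** The orbits of [face] are the regions of the diagram: that of [d] is the
  region on the right of [d], travelling away from the vertex of [d]. *)
Definition face (d : dart) : dart := ccw (opp d).

(** Euler's formula V + F = E + 2. *)
Definition spherical : bool :=
  fcard ccw dart + fcard face dart == fcard opp dart + 2.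

(** * Shortcuts *)

(** [crosses d s]: an arc which starts in the region of [d] and crosses
  successively the edges of the darts in [s], each from right to left, can end
  at the head. *)
Fixpoint crosses (d : dart) (s : seq dart) : bool :=
  if s is d' :: s' then fconnect face d d' && crosses (opp d') s'
  else fconnect face d head_dart.

(** A shortcut, up to isotopy fixing the diagram.  The regions are open disks, so
  an arc entering each of them at most once can be embedded; conversely an arc
  with the least number of crossings never returns to a region. *)
Definition shortcut (s : seq dart) : bool :=
  crosses tail_dart s && uniq [seq froot face d | d <- tail_dart :: map opp s].

(** * States *)

Section State.
(** The set of the crossings with an A-smoothing. *)
Variable S : {fset crossing}.

Definition oriented (c : crossing) : bool := (c \in S) == c.2.

(** The half-strand to which the smoothing joins [d]. *)
Definition smooth (d : dart) : dart :=
  if site d is Some (x, out)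
  then dart_at (mate x) (if oriented x.1 then ~~ out else out)
  else d.

Definition linked : rel dart := [rel d d' | (d' == opp d) || (d' == smooth d)].

Definition n_components : nat := n_comp linked dart.

(** Walk to the other end of the edge of [d] and through the next smoothing. *)
Definition advance (d : dart) : dart := smooth (opp d).

(** The cusp met in this walk, if any: [true] if its inside is on the right.
  Coming in along a half-strand and leaving along the next one counterclockwise,
  i.e. along its image under [ccw], one has the acute angle on the right;
  leaving along the previous one, on the left. *)
Definition cusp (d : dart) : option bool :=
  if site (opp d) is Some (x, _)
  then if oriented x.1 then None else Some (x.2 == x.1.2)
  else None.

Definition long_cusps : seq bool :=
  pmap cusp (traject advance tail_dart (findex advance tail_dart head_dart)).

(** Circular components have two orbits of [advance], one for each direction. *)
Definition loop_cusps (d : dart) : seq bool := pmap cusp (orbit advance d).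

(** One dart on each circular component. *)
Definition loops : {set dart} :=
  [set d | roots linked d & ~~ connect linked tail_dart d].
End State.
End Plane.

(** Cancellation of consecutive cusps with insides on the same side. *)
Definition cancel_cusps (s : seq bool) : seq bool :=
  foldr (fun b r => if r is b' :: r' then
                      if b == b' then r' else b :: r
                    else [:: b]) [::] s.

(** Every cusp reverses the orientation of the strand, so that a component has an
  even number of cusps.  For a circular component the surviving sequence
  alternates and has even length, so its last and first cusps do not cancel. *)
Definition half_surviving (s : seq bool) : nat := (size (cancel_cusps s))./2.

(** * The arrow polynomial *)

Local Open Scope ring_scope.

(** A field containing the ring Z[A, A^-1]. *)
Definition laurent := {fraction {poly int}}.
Definition varA : laurent := tofrac 'X.

(** [inl i] stands for K_i and [inr i] for Lambda_i. *)
Definition arrow_var : Type := (nat + nat)%type.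
Definition arrow_ring := {malg laurent[{cmonom arrow_var}]}.

Definition var (v : arrow_var) : arrow_ring := << ucm v >>.
Definition Kvar (i : nat) : arrow_ring := if i == 0%N then 1 else var (inl i).
Definition Lvar (i : nat) : arrow_ring := if i == 0%N then 1 else var (inr i).

Definition state_vars (w : gcode) (S : {fset crossing}) : arrow_ring :=
  Lvar (half_surviving (long_cusps w S)) *
  \prod_(d in loops w S) Kvar (half_surviving (loop_cusps S d)).

Definition arrow_polynomial (w : gcode) : arrow_ring :=
  \sum_(S <- fpowerset (crossings w))
    (varA ^ (#|` S|%:Z - #|` (crossings w `\` S)%fset|%:Z) *
     (- varA ^+ 2 - varA ^- 2) ^+ (n_components w S).-1) *: state_vars w S.

Definition monom_Lambda_degree (m : {cmonom arrow_var}) : nat :=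
  \max_(v <- finsupp m) (if v is inr i then i else 0%N).

Definition Lambda_degree (p : arrow_ring) : nat :=
  \max_(m <- msupp p) monom_Lambda_degree m.

Local Close Scope ring_scope.

(** * Knotoids *)

Record diagram := Diagram {
  code :> gcode;
  code_gauss : gauss code;
  code_spherical : spherical code }.

Definition isotopic (w w' : gcode) : Prop :=
  exists f : crossing -> crossing,
    [/\ injective f, forall c, (f c).2 = c.2
      & w' = [seq (f x.1, x.2) | x <- w]].

(** [strand dir x y] goes through [x] and [y], from [x] to [y] if [dir]. *)
Definition strand (dir : bool) (x y : passage) : gcode :=
  if dir then [:: x; y] else [:: y; x].

(** The Omega-moves, to be applied between codes of diagrams in the sphere.
  - In [Omega1] and [Omega2] the two consecutive passages, resp. the two pairs of
    consecutive passages, bound a monogon, resp. (the signs being opposite) a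
    bigon of the right-hand code.
  - In [Omega3] the top strand goes over at [a] and [b], the middle one under at
    [a] and over at [c], the bottom one under at [b] and [c].  The condition on
    the signs says that the three sides of the triangle [a], [b], [c] bound a
    region.  Indeed the side starting at a crossing in the direction [i] along
    the overpass (outgoing if [i]) is followed counterclockwise by that in the
    direction [j] along the underpass iff [(i == j)] equals the sign; [t], [m]
    and [l] being the directions of the strands from [a] to [b], from [a] to [c]
    and from [b] to [c], these booleans are [(t == m) == a.2],
    [(~~ t == l) == b.2] and [(~~ m == ~~ l) == c.2], and along the boundary of
    a region the first and the third one agree and differ from the second one. *)
Inductive omega : gcode -> gcode -> Prop :=
| Omega1 (w1 w2 : gcode) (c : crossing) (o : bool) :
    omega (w1 ++ w2) (w1 ++ [:: (c, o); (c, ~~ o)] ++ w2)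
| Omega2 (w1 w2 w3 : gcode) (c d : crossing) (o dir : bool) :
    c.2 != d.2 ->
    omega (w1 ++ w2 ++ w3)
      (w1 ++ [:: (c, o); (d, o)] ++ w2 ++ strand dir (c, ~~ o) (d, ~~ o) ++ w3)
| Omega3 (w0 w1 w2 w3 x y z : gcode) (a b c : crossing) (t m l : bool) :
    perm_eq [:: x; y; z] [:: strand t (a, true) (b, true);
                             strand m (a, false) (c, true);
                             strand l (b, false) (c, false)] ->
    ((t == m) == a.2) = ((t == l) == b.2) ->
    ((t == l) == b.2) = ((m == l) == c.2) ->
    omega (w0 ++ x ++ w1 ++ y ++ w2 ++ z ++ w3)
      (w0 ++ rev x ++ w1 ++ rev y ++ w2 ++ rev z ++ w3).

Definition step (D D' : diagram) : Prop := isotopic D D' \/ omega D D'.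

Definition equivalent : diagram -> diagram -> Prop :=
  clos_refl_sym_trans diagram step.

Record knotoid := Knotoid {
  represented :> diagram -> Prop;
  knotoid_class : exists D, forall D', represented D' <-> equivalent D D' }.

(** * Height *)

(** The least element of [P]; unspecified if [P] is empty. *)
Definition least (P : nat -> Prop) : nat :=
  epsilon (inhabits 0) (fun n => P n /\ forall k, P k -> n <= k).

Definition diagram_height (D : diagram) : nat :=
  least (fun k => exists s : seq (dart D), shortcut s /\ size s = k).

Definition knotoid_height (K : knotoid) : nat :=
  least (fun k => exists D : diagram, K D /\ diagram_height D = k).

(* Main.v *)
(* The cusps of a component, counted with the sign of the orientation in which
  they are met, have a sum whose absolute value is the number of surviving cusps.
  A state therefore amounts to a matching of ends by arcs with integer weights,
  and smoothing a crossing splices two arcs into it.  Splices commute, so that in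
  the state sum the crossings of a move can be smoothed first; the move then
  reduces to finitely many identities between formal sums of matchings of the
  boundary points, which are checked by computation.  Hence the Lambda-degree is
  an invariant of the knotoid, and it remains to bound it by the height of a
  diagram.

  A diagram and a shortcut with k crossings form together a closed curve on the
  sphere, whose complement has an Alexander numbering.  Let g be the mean of the
  numbers on both sides of a half-strand.  Walking along the long component of a
  state, g changes by 1 at each cusp, with the opposite of its sign, and by 1 at
  each crossing with the shortcut.  The long component meets the shortcut at most
  k times, and following the shortcut itself shows that the values of g at the
  endpoints differ by at most k; hence at most 2k cusps survive. *)

From Stdlib Require Import Relations ClassicalEpsilon.
From mathcomp Require Import all_boot all_order all_algebra finmap.
From mathcomp.multinomials Require Import monalg.
From mathcomp Require Import zify ring lra.
Require Import Defs.

Set Implicit Arguments.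
Unset Strict Implicit.
Unset Printing Implicit Defensive.

Import Order.TTheory GRing.Theory Num.Theory.

(** * Wirings *)

(** The walk along a state lives on darts, which are positions in the code: a move inserts or
    permutes passages and shifts them, so two diagrams related by a move share no set of darts. Ends
    named by passages survive a move, which is why states are recomputed as matchings of named ends.
    A check must also be independent of what lies outside the move. Dummy passages cut the strand
    open around it, so that a local state only matters through the way in which six boundary ends
    get joined, and with which weights. Loops closed inside are evaluated on the spot, which is
    possible because they turn out to have weight 0. No topological sphere is at hand for the
    Alexander numbering: planarity is nothing but the orbit count in [spherical]. The numbering is
    therefore found as a solution of linear equations over the rationals. Their solvability is the
    vanishing of the first cohomology of the sphere, which here is a comparison of ranks that
    Euler's formula makes tight. *)

Section Wiring.
Variable E : eqType.
Implicit Types (m : E -> E * int) (g : E * E * int) (gl L : seq (E * E * int)).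

Definition shift (y : E * int) (t : int) : E * int := (y.1, (y.2 + t)%R).

(* A matching [m] joins each end [x] to the end [(m x).1] by an arc of weight
  [(m x).2].  Splicing [(a, b, t)] joins [a] to [b] by an arc of weight [t]; the
  two ends, now interior, are left matched together with weight 0 (a junk value).
  Their partners are computed before [x] is known, so that iterated splices
  evaluate in linear time. *)
Definition splice m g : E -> E * int :=
  let: (a, b, t) := g in
  let ya := m a in let yb := m b in
  fun x =>
  if x == a then (b, 0%R) else if x == b then (a, 0%R) else
  let y := m x in
  if y.1 == a then shift yb (y.2 + t)%R
  else if y.1 == b then shift ya (y.2 - t)%R
  else y.

(** A closed arc has no preferred direction, and reversing it negates its weight; hence the absolute
    value. *)
Definition closes m g : seq nat :=
  let: (a, b, t) := g in
  if (m a).1 == b then [:: `|(t + (m b).2)%R|%N] else [::].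

Fixpoint run m gl : (E -> E * int) * seq nat :=
  if gl is g :: gl' then
    let r := run (splice m g) gl' in (r.1, closes m g ++ r.2)
  else (m, [::]).

Definition ends L : seq E := flatten [seq [:: z.1.1; z.1.2] | z <- L].

Lemma ends_cat L L' : ends (L ++ L') = ends L ++ ends L'.
Proof. by rewrite /ends map_cat flatten_cat. Qed.

Definition matching m : Prop :=
  forall x, m (m x).1 = (x, (- (m x).2)%R).

(** A matching may fix ends, with weight 0, as [lookup] does off its list; [moved] says that the
    given ends lie on actual arcs. *)
Definition moved m (s : seq E) : Prop := forall x, x \in s -> (m x).1 != x.

Lemma splice_matching m a b t :
  a != b -> (m a).1 != a -> (m b).1 != b ->
  matching m -> matching (splice m (a, b, t)).
Proof.
move=> ab ma mb Hm x.
have E1 := Hm a; have E2 := Hm b; have E3 := Hm x.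
rewrite /splice.
case: (eqVneq x a) => [->|xa] /=.
  by rewrite (negbTE (_ : b != a)) 1?eq_sym // eqxx oppr0.
case: (eqVneq x b) => [->|xb] /=; first by rewrite eqxx oppr0.
case: (eqVneq (m x).1 a) => [e|na] /=.
  rewrite e in E3; rewrite E3 /= in E1.
  have n1 : (m b).1 != a.
    by apply/eqP => e'; move: E2; rewrite e' E3 => -[] e2; rewrite e2 eqxx in xb.
  rewrite (negbTE n1) (negbTE mb) E2 /= eqxx (negbTE (_ : b != a)) 1?eq_sym //.
  by rewrite E3 /shift /=; congr (_, _); ring.
case: (eqVneq (m x).1 b) => [e|nb] /=.
  rewrite e in E3; rewrite E3 /= in E2.
  have n1 : (m a).1 != b.
    by apply/eqP => e'; move: E1; rewrite e' E3 => -[] e2; rewrite e2 eqxx in xa.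
  rewrite (negbTE n1) (negbTE ma) E1 /= eqxx.
  by rewrite E3 /shift /=; congr (_, _); ring.
by rewrite (negbTE na) (negbTE nb) E3 /= (negbTE xa) (negbTE xb).
Qed.

Lemma splice_moved m a b t s :
  a \notin s -> b \notin s -> a != b -> (m a).1 != a -> (m b).1 != b ->
  matching m -> moved m s -> moved (splice m (a, b, t)) s.
Proof.
move=> as_ bs ab ma mb Hm Hs x xs.
have xa : x != a by apply: contraNneq as_ => <-.
have xb : x != b by apply: contraNneq bs => <-.
rewrite /splice (negbTE xa) (negbTE xb).
have E3 := Hm x.
case: (eqVneq (m x).1 a) => [e|_].
  rewrite e in E3; apply/eqP => /= e2; have := Hm b; rewrite e2.
  by case Ex: (m x) e => [p1 q1] /= e; rewrite e => -[e3]; rewrite e3 eqxx in ab.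
case: (eqVneq (m x).1 b) => [e|_]; last exact: Hs.
rewrite e in E3; apply/eqP => /= e2; have := Hm a; rewrite e2.
by case Ex: (m x) e => [p1 q1] /= e; rewrite e => -[e3]; rewrite e3 eqxx in ab.
Qed.

Ltac split_tests :=
  repeat match goal with
  | |- context [?p == ?q] =>
    match p with
    | context [if _ then _ else _] => fail 1
    | _ => idtac
    end;
    let h := fresh in
    case: (eqVneq p q) => [h | /eqP h]; cbn [fst snd] in *; try (exfalso; congruence)
  end.

(** Both orders concatenate the same arcs. The equality also holds at the four spliced ends, because
    the junk value keeps them paired off and out of reach of the other splice. *)
Lemma spliceC m a b t c d t' x :
  uniq [:: a; b; c; d] -> matching m -> moved m [:: a; b; c; d] ->
  splice (splice m (a, b, t)) (c, d, t') x =
  splice (splice m (c, d, t')) (a, b, t) x.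
Proof.
move=> U Hm Hv.
have vd : (m d).1 <> d by apply/eqP/Hv; rewrite !inE eqxx ?orbT.
have vc : (m c).1 <> c by apply/eqP/Hv; rewrite !inE eqxx ?orbT.
have vb : (m b).1 <> b by apply/eqP/Hv; rewrite !inE eqxx ?orbT.
have va : (m a).1 <> a by apply/eqP/Hv; rewrite !inE eqxx ?orbT.
have inv y : (m (m y).1).1 = y by rewrite Hm.
have := inv a; have := inv b; have := inv c; have := inv d; have := inv x.
move=> ix id ic ib ia.
move: U; rewrite /= !inE !negb_or !andbT.
move=> /and3P[/and3P[/eqP ab /eqP ac /eqP ad] /andP[/eqP bc /eqP bd] /eqP cd].
rewrite /splice /shift; cbn [fst snd].
split_tests; try done.
all: try (congr (_, _); ring).
Qed.

(** When the two splices close a loop only together, it is recorded by whichever comes second, read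
    from another starting point and possibly backwards; the absolute value absorbs this. When each
    closes its own loop, only the order of the list changes. *)
Lemma closesC m a b t c d t' :
  uniq [:: a; b; c; d] -> matching m -> moved m [:: a; b; c; d] ->
  perm_eq (closes m (a, b, t) ++ closes (splice m (a, b, t)) (c, d, t'))
    (closes m (c, d, t') ++ closes (splice m (c, d, t')) (a, b, t)).
Proof.
move=> U Hm Hv.
have vd : (m d).1 <> d by apply/eqP/Hv; rewrite !inE eqxx ?orbT.
have vc : (m c).1 <> c by apply/eqP/Hv; rewrite !inE eqxx ?orbT.
have vb : (m b).1 <> b by apply/eqP/Hv; rewrite !inE eqxx ?orbT.
have va : (m a).1 <> a by apply/eqP/Hv; rewrite !inE eqxx ?orbT.
have inv y : (m (m y).1).1 = y by rewrite Hm.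
have := inv a; have := inv b; have := inv c; have := inv d.
move=> id ic ib ia.
have E1 (p q : nat) : p = q -> perm_eq [:: p] [:: q] by move=> ->.
have wt y z : (m y).1 = z -> (m z).2 = (- (m y).2)%R by move=> <-; rewrite Hm.
have := wt a; have := wt b; have := wt c; have := wt d.
move=> wd wc wb wa.
move: U; rewrite /= !inE !negb_or !andbT.
move=> /and3P[/and3P[/eqP ab /eqP ac /eqP ad] /andP[/eqP bc /eqP bd] /eqP cd].
rewrite /closes /splice /shift; cbn [fst snd].
split_tests; rewrite ?cats0 //=; try done.
- by rewrite perm_sym (perm_catC [:: _] [:: _]).
- have -> : (m b).2 = (- (m d).2)%R by apply: wd; congruence.
  have -> : (m a).2 = (- (m c).2)%R by apply: wc; congruence.
  by rewrite -abszN; apply: E1; congr absz; ring.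
- by apply: E1; congr absz; ring.
Qed.

Lemma run_cat m gl1 gl2 :
  run m (gl1 ++ gl2) =
  ((run (run m gl1).1 gl2).1, (run m gl1).2 ++ (run (run m gl1).1 gl2).2).
Proof.
elim: gl1 m => [|g gl1 IH] m /=; first by rewrite -surjective_pairing.
by rewrite IH /= catA.
Qed.

Lemma splice_closed (P : pred E) m a b t :
  a \in P -> b \in P -> (forall x, x \in P -> (m x).1 \in P) ->
  forall x, x \in P -> (splice m (a, b, t) x).1 \in P.
Proof.
move=> Pa Pb cl x Px; rewrite /splice.
by do ?case: ifP => _ /=; rewrite ?cl.
Qed.

(** A splice consults only the partners of its own two ends, so a run never looks outside a set that
    is stable under the matching. *)
Lemma run_agree (P : pred E) m1 m2 gl :
  (forall x, x \in P -> m1 x = m2 x) ->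
  (forall x, x \in P -> (m1 x).1 \in P) -> {subset ends gl <= P} ->
  [/\ (run m1 gl).2 = (run m2 gl).2,
      forall x, x \in P -> (run m1 gl).1 x = (run m2 gl).1 x
    & forall x, x \in P -> ((run m1 gl).1 x).1 \in P].
Proof.
elim: gl m1 m2 => [|[[a b] t] gl IH] m1 m2 e cl sub //=.
have Pa : a \in P by apply: sub; rewrite inE eqxx.
have Pb : b \in P by apply: sub; rewrite !inE eqxx orbT.
have [] := IH (splice m1 (a, b, t)) (splice m2 (a, b, t)).
- move=> x Px; rewrite /splice !e //.
- exact: splice_closed.
- by move=> x xs; apply: sub; rewrite !inE xs !orbT.
by move=> -> h1 h2; split=> //; rewrite /closes !e.
Qed.

Lemma run_ext m1 m2 gl : m1 =1 m2 ->
  (run m1 gl).2 = (run m2 gl).2 /\ (run m1 gl).1 =1 (run m2 gl).1.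
Proof.
move=> e; have [] // := @run_agree predT m1 m2 gl.
by move=> e1 e2 _; split=> // x; apply: e2.
Qed.

Definition wired m gl := [/\ uniq (ends gl), matching m & moved m (ends gl)].

Lemma wired_cons m a b t gl :
  wired m ((a, b, t) :: gl) -> wired (splice m (a, b, t)) gl.
Proof.
case=> /= /and3P[]; rewrite !inE negb_or => /andP[ab an] bn U Hm Hv.
have va : (m a).1 != a by apply: Hv; rewrite inE eqxx.
have vb : (m b).1 != b by apply: Hv; rewrite !inE eqxx orbT.
split=> //; first exact: splice_matching.
apply: splice_moved => // x xs; apply: Hv; by rewrite !inE xs !orbT.
Qed.

Lemma run_outside (P : pred E) m gl :
  wired m gl ->
  (forall x, x \in P -> (m x).1 \in P) -> {subset ends gl <= P} ->
  forall x, x \notin P -> (run m gl).1 x = m x.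
Proof.
elim: gl m => [|[[a b] t] gl IH] m //= w cl sub x Px.
have Pa : a \in P by apply: sub; rewrite inE eqxx.
have Pb : b \in P by apply: sub; rewrite !inE eqxx orbT.
rewrite IH //; first last.
- by move=> y ys; apply: sub; rewrite !inE ys !orbT.
- exact: splice_closed.
- exact: wired_cons.
case: w => _ Hm _.
have mP : (m x).1 \notin P by apply: contra Px => /cl; rewrite Hm.
rewrite /splice.
case: eqP => [e|_]; first by rewrite e Pa in Px.
case: eqP => [e|_]; first by rewrite e Pb in Px.
case: eqP => [e|_]; first by rewrite e Pa in mP.
by case: eqP => [e|_] //; rewrite e Pb in mP.
Qed.

Lemma run_front m g gl1 gl2 : wired m (gl1 ++ g :: gl2) ->
  (run m (gl1 ++ g :: gl2)).1 =1 (run m (g :: gl1 ++ gl2)).1 /\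
  perm_eq (run m (gl1 ++ g :: gl2)).2 (run m (g :: gl1 ++ gl2)).2.
Proof.
elim: gl1 m => [|[[a b] t] gl1 IH] m //= w.
have [e1 e2] := IH _ (wired_cons w).
clear IH; case: g => [[c d] t'] in w e1 e2 *.
case: w => U Hm Hv.
have sub : subseq [:: a; b; c; d] (ends ((a, b, t) :: gl1 ++ (c, d, t') :: gl2)).
  rewrite /= !eqxx -/(ends _) ends_cat.
  by apply: subseq_trans (suffix_subseq _ _); rewrite /= !eqxx sub0seq.
have U4 := subseq_uniq sub U.
have V4 : moved m [:: a; b; c; d] by move=> x xs; apply/Hv/(mem_subseq sub).
have [f1 f2] := run_ext (gl1 ++ gl2) (fun x => spliceC t t' x U4 Hm V4).
split=> [x|]; first by rewrite e1 /= f2.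
rewrite (perm_trans (perm_cat (perm_refl _) e2)) //= -/(run _ _) f1 !catA.
by rewrite perm_cat2r; apply: closesC.
Qed.

Lemma perm_ends L L' : perm_eq L L' -> perm_eq (ends L) (ends L').
Proof. by move=> h; apply: perm_flatten; apply: perm_map. Qed.

Lemma wired_perm m gl gl' : perm_eq gl gl' -> wired m gl -> wired m gl'.
Proof.
move=> /perm_ends h [U Hm Hv]; split=> //; first by rewrite -(perm_uniq h).
by move=> x; rewrite -(perm_mem h); apply: Hv.
Qed.

Lemma run_perm m gl gl' : wired m gl -> perm_eq gl gl' ->
  (run m gl).1 =1 (run m gl').1 /\ perm_eq (run m gl).2 (run m gl').2.
Proof.
elim: gl gl' m => [|g gl IH] gl' m w h.
  by have -> : gl' = [::] by apply/eqP; rewrite -size_eq0 -(perm_size h).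
have: g \in gl' by rewrite -(perm_mem h) inE eqxx.
move=> /path.splitPr e; case: e h => gl1 gl2 h.
have [f1 f2] := run_front (wired_perm h w).
have h' : perm_eq gl (gl1 ++ gl2).
  by rewrite -(perm_cons g) (perm_trans h) // perm_catC /= perm_cons perm_catC.
have w' : wired (splice m g) gl by case: g {h f1 f2} w => [[a b] t]; apply: wired_cons.
have [e1 e2] := IH _ _ w' h'.
split=> [x|]; first by rewrite f1 /= e1.
rewrite perm_sym (perm_trans f2) //= perm_sym.
by rewrite perm_cat2l.
Qed.

Definition lookup L (e : E) : E * int :=
  foldr (fun z r => if e == z.1.1 then (z.1.2, z.2)
                    else if e == z.1.2 then (z.1.1, (- z.2)%R) else r) (e, 0%R) L.

Lemma lookup_cat L1 L2 e :
  lookup (L1 ++ L2) e = if e \in ends L1 then lookup L1 e else lookup L2 e.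
Proof.
elim: L1 => [|[[a b] t] L1 IH] //=; rewrite !inE.
by case: eqP => //= _; case: eqP.
Qed.

Lemma lookup_notin L e : e \notin ends L -> lookup L e = (e, 0%R).
Proof.
elim: L => [|[[a b] t] L IH] //=; rewrite !inE !negb_or => /and3P[].
by move=> /negbTE-> /negbTE->.
Qed.

Lemma lookup_closed L e : e \in ends L -> (lookup L e).1 \in ends L.
Proof.
elim: L => [|[[a b] t] L IH] //=; rewrite !inE.
case: eqP => [_|_] /=; first by rewrite eqxx orbT.
case: eqP => [_|_] /=; first by rewrite eqxx.
by move=> /IH->; rewrite !orbT.
Qed.

Lemma lookup_in L a b t : uniq (ends L) -> (a, b, t) \in L ->
  lookup L a = (b, t) /\ lookup L b = (a, (- t)%R).
Proof.
elim: L => [|[[c d] t'] L IH] //= /and3P[].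
rewrite !inE negb_or => /andP[cd cn] dn U.
case/orP => [/eqP[-> -> ->]|h].
  by rewrite !eqxx eq_sym (negbTE cd).
have aL : a \in ends L.
  by apply/flattenP; exists [:: a; b]; rewrite ?inE ?eqxx //; apply/mapP; exists (a, b, t).
have bL : b \in ends L.
  by apply/flattenP; exists [:: a; b]; rewrite ?inE ?eqxx ?orbT //; apply/mapP; exists (a, b, t).
have ne x : x \in ends L -> (x == c = false) * (x == d = false).
  by move=> xL; split; apply/eqP => e; rewrite -e xL in cn dn.
by rewrite !(ne a) // !(ne b) //; apply: IH.
Qed.

Lemma endsP L e : reflect (exists a b t, (a, b, t) \in L /\ (e = a \/ e = b))
  (e \in ends L).
Proof.
apply: (iffP flattenP) => [[s /mapP[[[a b] t] zL ->]]|].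
  by rewrite !inE => /orP[]/eqP->; exists a, b, t; split=> //=; [left|right].
move=> [a [b [t [zL h]]]]; exists [:: a; b]; first by apply/mapP; exists (a, b, t).
by rewrite !inE; case: h => ->; rewrite eqxx ?orbT.
Qed.

Lemma lookup_perm L L' : uniq (ends L) -> perm_eq L L' -> lookup L =1 lookup L'.
Proof.
move=> U h e; have U' : uniq (ends L') by rewrite -(perm_uniq (perm_ends h)).
case: (boolP (e \in ends L)) => [/endsP[a [b [t [zL ee]]]]|n].
  have [e1 e2] := lookup_in U zL.
  have [] := lookup_in U' (_ : (a, b, t) \in L'); first by rewrite -(perm_mem h).
  by move=> e3 e4; case: ee => ->; rewrite ?e1 ?e2.
by rewrite !lookup_notin // -(perm_mem (perm_ends h)).
Qed.

Lemma lookup_matching L : uniq (ends L) -> matching (lookup L).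
Proof.
move=> U e; case: (boolP (e \in ends L)) => [/endsP[a [b [t [zL ee]]]]|n].
  by have [e1 e2] := lookup_in U zL; case: ee => ->; rewrite ?e1 ?e2 /= ?e1 ?e2 ?opprK.
by rewrite (lookup_notin n) /= (lookup_notin n) oppr0.
Qed.

Lemma lookup_moved L : uniq (ends L) -> moved (lookup L) (ends L).
Proof.
elim: L => [|[[a b] t] L IH] //= /and3P[].
rewrite inE negb_or => /andP[ab an] bn U e.
rewrite !inE /=; case: (eqVneq e a) => [->|_] /=; first by rewrite eq_sym.
case: (eqVneq e b) => [->|_] //= h; exact: IH U e h.
Qed.

End Wiring.

Section Relabel.
Variables (E E' : eqType) (phi : E -> E').
Hypothesis phi_inj : injective phi.

Definition relabel (z : E * E * int) := (phi z.1.1, phi z.1.2, z.2).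

Lemma run_relabel (m : E -> E * int) (m' : E' -> E' * int) gl :
  (forall x, m' (phi x) = (phi (m x).1, (m x).2)) ->
  (run m' (map relabel gl)).2 = (run m gl).2 /\
  forall x, (run m' (map relabel gl)).1 (phi x) =
    (phi ((run m gl).1 x).1, ((run m gl).1 x).2).
Proof.
elim: gl m m' => [|[[a b] t] gl IH] m m' h //=.
have [|-> e] := IH (splice m (a, b, t)) (splice m' (phi a, phi b, t)).
  move=> x; rewrite /splice !h /= !(inj_eq phi_inj) /shift.
  by do ?case: eqP => //= _.
by split=> //; rewrite /closes !h /= !(inj_eq phi_inj).
Qed.

Lemma lookup_relabel L x :
  lookup (map relabel L) (phi x) = (phi (lookup L x).1, (lookup L x).2).
Proof.
elim: L => [|[[a b] t] L IH] //=; rewrite !(inj_eq phi_inj).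
by case: eqP => //= _; case: eqP.
Qed.

Lemma ends_relabel L : ends (map relabel L) = map phi (ends L).
Proof. by elim: L => [|[[a b] t] L IH] //=; do 2!congr (_ :: _). Qed.

End Relabel.

(** * Components of a state *)

Lemma sum_traject (V : nmodType) (T : Type) (f : T -> T) (F : T -> V) x n :
  (\sum_(y <- traject f x n) F y = \sum_(i < n) F (iter i f x))%R.
Proof.
elim: n => [|n IH]; first by rewrite big_nil big_ord0.
by rewrite trajectSr -cats1 big_cat big_seq1 IH big_ord_recr.
Qed.

Section Components.
Variables (V : finType) (op q : V -> V) (th : V -> int).
Hypotheses (opK : involutive op) (qK : involutive q)
  (op_ne : forall x, op x != x) (th_q : forall x, th (q x) = (- th x)%R).

Definition walk (x : V) : V := q (op x).
Definition wt (x : V) : int := th (op x).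
Definition joined : rel V := [rel x y | (y == op x) || (y == q x)].
Definition hol (x : V) : nat := `|(\sum_(y | fconnect walk x y) wt y)%R|%N.
Definition no_end (x : V) : bool := ~~ [exists y, connect joined x y && (q y == y)].

Lemma walk_inj : injective walk.
Proof. exact: inj_comp (inv_inj qK) (inv_inj opK). Qed.

Lemma joined_sym : symmetric joined.
Proof.
move=> x y; rewrite /joined /=; congr (_ || _).
  by apply/eqP/eqP => ->; rewrite opK.
by apply/eqP/eqP => ->; rewrite qK.
Qed.

Lemma connect_joined_sym : connect_sym joined.
Proof. exact: sym_connect_sym joined_sym. Qed.

Lemma connect_walk n x : connect joined x (iter n walk x).
Proof.
elim: n => [|n IH] //=; apply: connect_trans IH _.
set y := iter n walk x.
apply: (@connect_trans _ _ (op y)); apply: connect1; rewrite /joined /= eqxx //.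
by rewrite orbT.
Qed.

Lemma walk_op_walk x : walk (op (walk x)) = op x.
Proof. by rewrite /walk opK qK. Qed.

Lemma fconnect_walk_op x y : fconnect walk (op x) (op y) = fconnect walk x y.
Proof.
have half u v : fconnect walk u v -> fconnect walk (op u) (op v).
  move=> /iter_findex <-; elim: (findex _ _ _) => [|n IH] //=.
  rewrite (same_fconnect1_r walk_inj) walk_op_walk; exact: IH.
by apply/idP/idP => [/half|/half //]; rewrite !opK.
Qed.

(** [op] carries the orbit to that of the opposite direction of travel, in which each junction is
    passed from its other side; by [th_q] its weight is negated. *)
Lemma hol_op x : hol (op x) = hol x.
Proof.
rewrite /hol -[RHS]abszN; congr absz.
rewrite (reindex_inj (inv_inj opK)) /=.
rewrite (eq_bigl _ _ (fun y => fconnect_walk_op x y)).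
rewrite (reindex_inj walk_inj) /= -sumrN.
rewrite (eq_bigl _ _ (fun y => esym (same_fconnect1_r walk_inj x y))).
by apply: eq_bigr => y _; rewrite /wt opK /walk th_q.
Qed.

Lemma hol_walk x : hol (walk x) = hol x.
Proof.
by rewrite /hol (eq_bigl _ _ (fun y => esym (same_fconnect1 walk_inj x y))).
Qed.

Lemma hol_joined x y : connect joined x y -> hol x = hol y.
Proof.
case/connectP => p; elim: p x => [|z p IH] x /= => [_ -> //|/andP[xz pz] e].
rewrite -(IH z pz e); case/orP: xz => /eqP->; first by rewrite hol_op.
by rewrite -{2}[x]opK -[q _]/(walk _) hol_walk hol_op.
Qed.

Lemma no_end_joined x y : connect joined x y -> no_end x = no_end y.
Proof.
move=> xy; congr (~~ _); apply: eq_existsb => z.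
by rewrite (same_connect connect_joined_sym xy).
Qed.

(* The stage of the process at which only the ends in [A] are still free:
  [m] is the first return of the walk to [A]. *)
Record stage (A : {set V}) (m : V -> V * int) : Prop := Stage {
  stage_matching : matching m;
  stage_closed : forall x, x \in A -> (m x).1 \in A;
  stage_q : forall x, x \in A -> q x \in A;
  stage_fixed : forall x, q x = x -> x \in A;
  stage_return : forall x, x \in A -> exists n,
    [/\ iter n.+1 walk x = q (m x).1,
        forall i, 0 < i <= n -> iter i walk x \notin A
      & (\sum_(i < n.+1) wt (iter i walk x))%R = ((m x).2 + th (m x).1)%R];
  stage_connect : forall x y, x \in A -> y \in A -> connect joined x y ->
    connect [rel x y | (y == (m x).1) || (y == q x)] x y }.

Definition joined_at (m : V -> V * int) : rel V :=
  [rel x y | (y == (m x).1) || (y == q x)].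

Lemma stage0 : stage setT (fun x => (op x, 0%R)).
Proof.
split=> //= [x|x _].
  by rewrite opK oppr0.
exists 0; split=> // [[|i] //|]; by rewrite big_ord1 /= add0r.
Qed.

(** In the sum over a return, the term [th (m x).1] belongs to the junction at the far end of the
    arc, through which the last step passes although it is not spliced yet. Splicing that junction
    absorbs the term into the weight of the longer arc. *)
Lemma stage_step_return A m a x : stage A m ->
  a \in A -> q a != a -> (m a).1 != a -> (m (q a)).1 != q a ->
  x \in A :\: [set a; q a] ->
  let m' := splice m (a, q a, th a) in exists n,
    [/\ iter n.+1 walk x = q (m' x).1,
        forall i, 0 < i <= n -> iter i walk x \notin A :\: [set a; q a]
      & (\sum_(i < n.+1) wt (iter i walk x))%R = ((m' x).2 + th (m' x).1)%R].
Proof.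
move=> [Hm cl clq fx ret _] Aa qa ma mb; set b := q a in qa mb *.
rewrite in_setD in_set2 negb_or => /andP[/andP[xa xb] Ax] m'.
have Ab : b \in A by apply: clq.
(* The walk returns to [A] at [c], one of the two ends being removed. This no longer counts as a
   return, so the walk goes on along the arc from [c]. *)
have chain c : c \in A -> c \in [set a; b] -> q (m x).1 = c -> exists n,
    [/\ iter n.+1 walk x = q (m c).1,
        forall i, 0 < i <= n -> iter i walk x \notin A :\: [set a; b]
      & (\sum_(i < n.+1) wt (iter i walk x))%R =
        ((m x).2 + th (m x).1 + ((m c).2 + th (m c).1))%R].
  move=> Ac cab e.
  have [n1 [e1 d1 s1]] := ret _ Ax; have [n2 [e2 d2 s2]] := ret _ Ac.
  rewrite e in e1.
  have step i : iter (n1.+1 + i) walk x = iter i walk c.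
    by rewrite addnC iterD e1.
  exists (n1.+1 + n2); split.
  - by rewrite -addnS step.
  - move=> i /andP[i0 le]; rewrite in_setD negb_and negbK.
    case: (ltngtP i n1.+1) => [lt|lt|->].
    + by rewrite d1 ?orbT // i0 -ltnS.
    + by rewrite -(subnKC (ltnW lt)) step d2 ?orbT //; lia.
    + by rewrite -[n1.+1]addn0 step /= cab.
  - rewrite -addnS big_split_ord /= s1 -s2; congr (_ + _)%R.
    by apply: eq_bigr => i _; rewrite -step.
rewrite /m' /splice (negbTE xa) (negbTE xb).
case: (eqVneq (m x).1 a) => [e|na].
  have [n [h1 h2 h3]] := chain b Ab (set22 _ _) (congr1 q e).
  exists n; split=> //=; rewrite h3 e; lra.
case: (eqVneq (m x).1 b) => [e|nb].
  have [n [h1 h2 h3]] := chain a Aa (set21 _ _) (etrans (congr1 q e) (qK a)).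
  exists n; split=> //=; rewrite h3 e th_q; lra.
have [n [h1 h2 h3]] := ret _ Ax; exists n; split=> // i /h2.
by rewrite in_setD negb_and => ->; rewrite orbT.
Qed.

(** With [u] the identity this confines a path to a set; with a contraction [u] it reroutes a path
    around removed ends. *)
Lemma connect_lift (T T' : finType) (e : rel T) (e' : rel T') (P : pred T)
    (u : T -> T') :
  (forall x y, P x -> e x y -> P y /\ connect e' (u x) (u y)) ->
  forall x y, P x -> connect e x y -> P y /\ connect e' (u x) (u y).
Proof.
move=> h x y Px /connectP[p pp ->]; elim: p x Px pp => [|z p IH] x Px /=.
  by move=> _; split.
case/andP => xz pz; have [Pz uz] := h _ _ Px xz.
by have [? h2] := IH z Pz pz; split=> //; apply: connect_trans uz h2.
Qed.

Lemma stage_step A m a : stage A m ->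
  a \in A -> q a != a -> (m a).1 != a -> (m (q a)).1 != q a ->
  stage (A :\: [set a; q a]) (splice m (a, q a, th a)).
Proof.
move=> st Aa qa ma mb.
have ret := stage_step_return st Aa qa ma mb.
case: st => Hm cl clq fx _ con.
set b := q a in qa mb ret *; set m' := splice _ _ in ret *.
have ab : a != b by rewrite eq_sym.
have Ab : b \in A by apply: clq.
have Hm' : matching m' by apply: splice_matching.
have cl' x : x \in A :\: [set a; b] -> (m' x).1 \in A :\: [set a; b].
  rewrite !in_setD !in_set2 => /andP[nx Ax]; apply/andP; split.
    apply: contra nx => /orP[]/eqP e; have := Hm' x; rewrite e /m' /splice.
      by rewrite eqxx => -[<-]; rewrite eqxx orbT.
    by rewrite eq_sym (negbTE ab) eqxx => -[<-]; rewrite eqxx.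
  by apply: splice_closed => // y; apply: cl.
split=> //.
- move=> x; rewrite !in_setD !in_set2 => /andP[nx Ax]; rewrite clq // andbT.
  apply: contra nx => /orP[]/eqP e; rewrite -[x]qK e ?eqxx ?orbT //.
  by rewrite qK eqxx.
- move=> x e; rewrite in_setD in_set2 fx // andbT; apply/norP; split.
    by apply: contraNneq qa => e2; rewrite /b -e2 e.
  apply: contraNneq ab => e2.
  by rewrite -(inj_eq (inv_inj qK)) -/b -e2 e.
move=> x y; rewrite !in_setD !in_set2 => /andP[nx Ax] /andP[ny Ay] xy.
have {xy}xy := con _ _ Ax Ay xy.
(* If the splice closes a loop, [a] and [b] are cut off from the other free ends, so paths between
   the latter avoid them. *)
case: (eqVneq (m a).1 b) => [mab|mab].
  have mba : (m b).1 = a by rewrite -mab Hm.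
  have xA : x \in A :\: [set a; b] by rewrite in_setD in_set2 nx.
  refine (proj2 (@connect_lift _ _ (joined_at m) (joined_at m')
    (fun z => z \in A :\: [set a; b]) id _ x y xA xy)).
  move=> z w; rewrite /= !in_setD !in_set2 => /andP[nz Az] /orP[]/eqP->.
    have e : m' z = m z.
      rewrite /m' /splice; case/norP: (nz) => /negbTE-> /negbTE->.
      case: eqP => [e|_]; first by rewrite -[z](congr1 fst (Hm z)) /= e mab eqxx orbT in nz.
      case: eqP => [e|_] //.
      by move: nz; rewrite -[z](congr1 fst (Hm z)) /= e mba eqxx.
    split; last by apply: connect1; rewrite /joined_at /= e eqxx.
    by have := cl' z; rewrite !in_setD !in_set2 e; apply; rewrite nz.
  split; last by apply: connect1; rewrite /joined_at /= eqxx orbT.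
  rewrite clq // andbT; apply: contra nz => /orP[]/eqP e; rewrite -[z]qK e ?eqxx ?orbT //.
  by rewrite qK eqxx.
(* Otherwise [u] slides each spliced end along its arc to the far end; the two far ends are joined
   by the new arc. *)
pose u z := if z == a then (m a).1 else if z == b then (m b).1 else z.
have ux z : ~~ ((z == a) || (z == b)) -> u z = z.
  by rewrite /u => /norP[/negbTE-> /negbTE->].
have mba : (m b).1 != a by apply: contraNneq mab => <-; rewrite Hm.
have ub : u b = (m b).1 by rewrite /u eq_sym (negbTE ab) eqxx.
have ua : u a = (m a).1 by rewrite /u eqxx.
have m'a : (m' (m a).1).1 = (m b).1.
  by rewrite /m' /splice (negbTE ma) (negbTE mab) Hm /= eqxx.
rewrite -(ux x nx) -(ux y ny).
refine (proj2 (@connect_lift _ _ (joined_at m) (joined_at m') predT u _ x y isT xy)).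
move=> z w _ /orP[]/eqP->; split=> //.
  case: (eqVneq z a) => [->|za]; first by rewrite ua ux // negb_or ma mab.
  case: (eqVneq z b) => [->|zb]; first by rewrite ub ux // negb_or mb mba.
  have nz : ~~ ((z == a) || (z == b)) by rewrite negb_or za.
  case: (eqVneq (m z).1 a) => [e|nza].
    by rewrite e ua (ux _ nz) -[z](congr1 fst (Hm z)) e /=.
  case: (eqVneq (m z).1 b) => [e|nzb].
    by rewrite e ub (ux _ nz) -[z](congr1 fst (Hm z)) e /=.
  rewrite (ux z nz) ux; last by rewrite negb_or nza.
  apply: connect1; rewrite /joined_at /= /m' /splice.
  by rewrite (negbTE za) (negbTE zb) (negbTE nza) (negbTE nzb) eqxx.
case: (eqVneq z a) => [->|za].
  by rewrite -/b ua ub; apply: connect1; rewrite /joined_at /= m'a eqxx.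
case: (eqVneq z b) => [->|zb].
  rewrite /b qK -/b ua ub; apply: connect1; rewrite /joined_at /=.
  by rewrite -[(m a).1](congr1 fst (Hm' (m a).1)) m'a eqxx.
rewrite (ux z) ?negb_or ?za // ux; first by apply: connect1; rewrite /joined_at /= eqxx orbT.
rewrite negb_or; apply/andP; split; last by apply: contraNneq za => /(inv_inj qK)->.
by apply: contraNneq zb => e; rewrite /b -e qK.
Qed.

Lemma hol_order x :
  hol x = `|(\sum_(i < fingraph.order walk x) wt (iter i walk x))%R|%N.
Proof.
rewrite /hol; congr absz.
rewrite (eq_bigl (fun y => y \in orbit walk x)); last by move=> y; rewrite fconnect_orbit.
by rewrite -big_uniq ?orbit_uniq //= /orbit sum_traject.
Qed.

Lemma hol_return x n :
  iter n.+1 walk x = x -> (forall i, 0 < i <= n -> iter i walk x != x) ->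
  hol x = `|(\sum_(i < n.+1) wt (iter i walk x))%R|%N.
Proof.
move=> e d; rewrite hol_order.
suff -> : fingraph.order walk x = n.+1 by [].
apply/eqP; rewrite eqn_leq; apply/andP; split.
  rewrite leqNgt; apply/negP => lt.
  by have := findex_iter lt; rewrite e findex0.
rewrite ltnNge; apply/negP => le.
have := d _ (introT andP (conj (fingraph.order_gt0 _ _) le)).
by rewrite (iter_order walk_inj) eqxx.
Qed.

Section Product.
Variables (R : comPzRingType) (kap : nat -> R).

Definition meets (A : {set V}) (r : V) : bool := [exists y in A, connect joined r y].

(** The circular components that still have a free end, that is, those not yet closed by a
    splice. *)
Definition loop_prod (A : {set V}) : R :=
  (\prod_(r | roots joined r && no_end r && meets A r) kap (hol r))%R.

(** A component loses its last free ends exactly when the spliced ends are partners of each other;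
    otherwise the partner of [a] remains free on the same component. *)
Lemma loop_prod_step A m a : stage A m ->
  a \in A -> q a != a -> (m a).1 != a -> (m (q a)).1 != q a ->
  loop_prod A = ((\prod_(l <- closes m (a, q a, th a)) kap l) *
                 loop_prod (A :\: [set a; q a]))%R.
Proof.
move=> st Aa qa ma mb; have st' := stage_step st Aa qa ma mb.
have Ab : q a \in A by apply: (stage_q st).
have Hm := stage_matching st.
rewrite /closes; case: (eqVneq (m a).1 (q a)) => mab; last first.
  rewrite big_nil mul1r; apply: eq_bigl => r; congr (_ && _).
  apply/existsP/existsP => [][y /andP[Ay ry]]; last first.
    by exists y; move: Ay; rewrite in_setD => /andP[_ ->].
  have conA : connect joined a (m a).1.
    have [n [e _ _]] := stage_return st Aa; have := connect_walk n.+1 a; rewrite e.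
    by move/connect_trans; apply; apply: connect1; rewrite /joined /= qK eqxx orbT.
  case: (boolP (y \in A :\: [set a; q a])) => [yA|]; first by exists y; rewrite yA.
  rewrite in_setD Ay andbT negbK in_set2 => yab.
  exists (m a).1; rewrite in_setD in_set2 negb_or ma mab (stage_closed st) //=.
  apply: connect_trans ry _; apply: connect_trans conA.
  case/orP: yab => /eqP-> //; rewrite connect_joined_sym.
  by apply: connect1; rewrite /joined /= eqxx orbT.
have mba : (m (q a)).1 = a by rewrite -mab Hm.
rewrite big_seq1.
have only y : y \in A -> connect joined a y -> (y == a) || (y == q a).
  move=> Ay /(stage_connect st Aa Ay) h.
  have [] // := @connect_lift _ _ (joined_at m) (joined_at m)
    (fun z => (z == a) || (z == q a)) id _ a y _ h; last by rewrite eqxx.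
  move=> z w h1 h2; split; last exact: connect1.
  move: h2; case/orP: h1 => /eqP-> /=; rewrite /joined_at /= ?mab ?mba ?qK;
    by case/orP=> /eqP-> /=; rewrite eqxx ?orbT.
have rt : connect joined a (fingraph.root joined a) by exact: connect_root.
have ne : no_end a.
  apply/existsP => -[y /andP[ay /eqP qy]].
  case/orP: (only y (stage_fixed st qy) ay) => /eqP e; rewrite e in qy.
    by move/eqP: qa; apply.
  by move/eqP: qa; apply; rewrite -[LHS]qy qK.
rewrite /loop_prod (bigD1 (fingraph.root joined a)) /=; last first.
  rewrite roots_root ?connect_joined_sym //=; last exact: connect_joined_sym.
  rewrite -(no_end_joined rt) ne /=.
  by apply/existsP; exists a; rewrite Aa connect_joined_sym.
congr (_ * _)%R.
  rewrite -(hol_joined rt).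
  have [n [e d s]] := stage_return st Aa.
  rewrite mab qK in e.
  rewrite (hol_return e) => [|i hi]; last by apply: contraTneq Aa => <-; apply: d.
  have -> : (m (q a)).2 = (- (m a).2)%R by rewrite -mab Hm.
  by rewrite s mab th_q -abszN; congr (kap (absz _)); lia.
apply: eq_bigl => r; rewrite -!andbA.
case: (boolP (roots joined r)) => //= rr; case: (no_end r) => //=.
apply/andP/existsP => [[/existsP[y /andP[Ay ry]] nr]|[y /andP[Ay ry]]].
  exists y; rewrite ry andbT in_setD Ay andbT in_set2; apply: contra nr => yab.
  rewrite -(eqP rr) (root_connect connect_joined_sym).
  apply: connect_trans ry _; case/orP: yab => /eqP-> //; rewrite connect_joined_sym.
  by apply: connect1; rewrite /joined /= eqxx orbT.
move: Ay; rewrite in_setD in_set2 => /andP[nab Ay]; split.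
  by apply/existsP; exists y; rewrite Ay.
apply: contra nab => /eqP e; apply: only => //; apply: connect_trans rt _.
by rewrite -e.
Qed.

Lemma run_stage A m gl : stage A m -> (forall x, x \in A -> (m x).1 != x) ->
  {subset ends gl <= A} -> uniq (ends gl) ->
  (forall a b t, (a, b, t) \in gl -> b = q a /\ t = th a) ->
  [/\ stage (A :\: [set x in ends gl]) (run m gl).1,
      forall x, x \in A :\: [set x in ends gl] -> ((run m gl).1 x).1 != x
    & loop_prod A = ((\prod_(l <- (run m gl).2) kap l) *
                 loop_prod (A :\: [set x in ends gl]))%R].
Proof.
elim: gl A m => [|[[a b] t] gl IH] A m st mv sub U glq.
  have -> : A :\: [set x in @ends V [::]] = A by apply/setP => x; rewrite !inE.
  by rewrite /= big_nil mul1r; split.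
have [eb et] : b = q a /\ t = th a by apply: glq; rewrite inE eqxx.
subst b t; move: U => /= /and3P[]; rewrite inE negb_or => /andP[ab an] bn U.
have Aa : a \in A by apply: sub; rewrite inE eqxx.
have Ab : q a \in A by apply: sub; rewrite !inE eqxx orbT.
have qa : q a != a by rewrite eq_sym.
have st' := stage_step st Aa qa (mv _ Aa) (mv _ Ab).
have E : A :\: [set x in [:: a, q a & ends gl]] =
    A :\: [set a; q a] :\: [set x in ends gl].
  by apply/setP => x; rewrite !inE !negb_or !andbA [_ && (x \notin ends gl)]andbC -!andbA.
rewrite -/(ends _) E.
have [] := IH _ _ st'.
- move=> x; rewrite in_setD in_set2 => /andP[nx Ax].
  apply: (@splice_moved _ m a (q a) (th a) [:: x]) => //; rewrite ?inE ?mv //.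
  + by apply: contra nx => /eqP->; rewrite eqxx.
  + by apply: contra nx => /eqP->; rewrite eqxx orbT.
  + exact: (stage_matching st).
  + by move=> y; rewrite inE => /eqP->; apply: mv.
- move=> x xs; rewrite in_setD in_set2 sub ?inE ?xs ?orbT // andbT.
  apply/norP; split; first by apply: contraNneq an => <-.
  by apply: contraNneq bn => <-.
- exact: U.
- by move=> a' b' t' h; apply: glq; rewrite inE h orbT.
move=> h1 h2 h3; split=> //.
by rewrite (loop_prod_step st Aa qa (mv _ Aa) (mv _ Ab)) h3 big_cat mulrA.
Qed.

(** After all splices the free ends are the fixed points of [q]. A component without end then has no
    free end, so every circular one has been recorded, and the arc from a fixed point is a whole
    component with ends. *)
Lemma run_components gl : uniq (ends gl) ->
  (forall a b t, (a, b, t) \in gl -> b = q a /\ t = th a) ->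
  (forall x, (x \in ends gl) = (q x != x)) ->
  let r := run (fun x => (op x, 0%R)) gl in
  (\prod_(l <- r.2) kap l = \prod_(r | roots joined r && no_end r) kap (hol r))%R /\
  forall x, q x = x -> exists n, [/\ iter n.+1 walk x = (r.1 x).1,
     forall i, 0 < i <= n -> q (iter i walk x) != iter i walk x,
     q (r.1 x).1 = (r.1 x).1, (r.1 x).1 != x &
     (\sum_(i < n.+1) wt (iter i walk x))%R = (r.1 x).2].
Proof.
move=> U glq all_ends r.
have sub0 : {subset ends gl <= [set: V]} by move=> x _; rewrite inE.
have [] := run_stage stage0 (fun x _ => op_ne x) sub0 U glq.
set A := _ :\: _ => st mv h.
have inA x : (x \in A) = (q x == x).
  by rewrite /A in_setD !inE all_ends negbK andbT.
split.
  have -> : (\prod_(r | roots joined r && no_end r) kap (hol r) = loop_prod setT)%R.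
    apply: eq_bigl => y; case: (_ && _) => //=.
    by apply/esym/existsP; exists y; rewrite inE connect0.
  rewrite h -[LHS]mulr1; congr (_ * _)%R; symmetry.
  apply: big1_seq => y /andP[/andP[/andP[_ /existsP ny] /existsP[z /andP[zA yz]]] _].
  by case: ny; exists z; rewrite yz -inA.
move=> x qx.
have Ax : x \in A by rewrite inA qx eqxx.
have [n [h1 h2 h3]] := stage_return st Ax.
have mA := stage_closed st Ax; have qmA : q (r.1 x).1 = (r.1 x).1 by apply/eqP; rewrite -inA.
exists n; split=> //.
- by rewrite h1.
- by move=> i hi; rewrite -inA; apply: h2.
- exact: mv.
- rewrite h3 -[RHS]addr0; congr (_ + _)%R.
  (* At a fixed point of [q] the weight equals its own opposite, so the far end contributes 0. *)
  have := th_q (r.1 x).1; rewrite qmA; move: (th _) => z e; lia.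
Qed.
End Product.
End Components.

(** * States of a Gauss code *)

Definition eps (b : bool) : int := if b then 1%R else (-1)%R.

Definition alt_sum (s : seq bool) : int := foldr (fun b r => (eps b - r)%R) 0%R s.

(** Removing two equal neighbours preserves the alternating sum, and on an alternating sequence all
    its terms have the same sign. The invariant keeps track of that sign, which is the one of the
    first surviving cusp. *)
Lemma size_cancel_cusps s : size (cancel_cusps s) = `|alt_sum s|%N.
Proof.
pose inv (r : seq bool) (z : int) :=
  if r is b :: _ then z = (eps b * (size r)%:Z)%R else z = 0%R.
suff [h _] : inv (cancel_cusps s) (alt_sum s) /\
    sorted (fun a b : bool => a != b) (cancel_cusps s).
  by move: h; case: (cancel_cusps s) => [|b r] /= -> //; rewrite /eps; case: b; lia.
elim: s => [|b s [IH IHs]] //=; rewrite -/(cancel_cusps s).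
move: (cancel_cusps s) IH IHs => [|b' r] /= IH IHs.
  by rewrite IH; split=> //; rewrite /eps; case: b.
case: eqP => [->|/eqP ne].
  move: IHs; case: r IH => [|b2 r] /= IH.
    by rewrite IH; split=> //; rewrite /eps; case: (b').
  case/andP=> ne ->; split=> //.
  by move: ne IH; rewrite /eps; case: (b'); case: b2 => //= _ ->; lia.
split; last by rewrite /= ne.
by move: ne IH; rewrite /eps; case: (b'); case: (b) => //= _ ->; lia.
Qed.

Section Darts.
Variable w : gcode.
Hypothesis wg : gauss w.

Let wU : uniq w. Proof. by case/andP: wg. Qed.

Lemma mateK : involutive mate.
Proof. by case=> c b; rewrite /mate /= negbK. Qed.

Lemma mate_in x : (mate x \in w) = (x \in w).
Proof.
have h y : y \in w -> mate y \in w by case/andP: wg => _ /allP; apply.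
by apply/idP/idP => /h //; rewrite mateK.
Qed.

Lemma oppK : involutive (@opp w).
Proof. by case=> e b; rewrite /opp /= negbK. Qed.

Lemma opp_ne (d : dart w) : opp d != d.
Proof. by case: d => e [] /=; rewrite /opp xpair_eqE /= andbF. Qed.

Lemma tail_head : tail_dart w != head_dart w.
Proof. by rewrite /tail_dart /head_dart xpair_eqE /= andbF. Qed.

Lemma site_dart_at x out : x \in w -> site (dart_at w x out) = Some (x, out).
Proof.
move=> xw; have lt : index x w < size w by rewrite index_mem.
have h : onth w (index x w) = Some x by rewrite onthE (nth_map x) // nth_index.
by case: out; rewrite /site /dart_at /= inordK ?ltnS // 1?ltnW //= h.
Qed.

Lemma site_inv (d : dart w) x out :
  site d = Some (x, out) -> x \in w /\ dart_at w x out = d.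
Proof.
have key (i : nat) y : onth w i = Some y -> y \in w /\ index y w = i.
  move=> h; have lt : i < size w by rewrite -onthTE h.
  have e : nth y w i = y by apply: onth_nth.
  by split; [rewrite -[X in X \in _]e mem_nth | rewrite -[X in index X _]e index_uniq].
case: d => [[e lt] []]; rewrite /site /=.
  case E: (onth w e) => [y|] //= [<- <-]; have [yw iy] := key _ _ E.
  by split=> //; rewrite /dart_at iy; congr (_, _); apply: val_inj; rewrite /= inordK.
case: e lt => [|e] lt //=; case E: (onth w e) => [y|] //= [<- <-].
have [yw iy] := key _ _ E.
by split=> //; rewrite /dart_at iy; congr (_, _); apply: val_inj; rewrite /= inordK.
Qed.

Lemma site_None (d : dart w) : site d = None -> d = tail_dart w \/ d = head_dart w.
Proof.
case: d => [[e lt] []]; rewrite /site /=.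
  case E: (onth w e) => [y|] //= _; right; congr (_, _); apply: val_inj => /=.
  by apply/eqP; rewrite eqn_leq -ltnS lt -onthNE E.
case: e lt => [|e] lt /=; first by left; congr (_, _); apply: val_inj.
by case E: (onth w e) => [y|] //=; have := lt; rewrite [_ < _]ltnS -onthTE E.
Qed.

Lemma site_tail : site (tail_dart w) = None.
Proof. by []. Qed.

Lemma site_head : site (head_dart w) = None.
Proof. by rewrite /site /= onth_default. Qed.

Section State.
Variable S : {fset crossing}.

(* The sign of the orientation in which a cusp is met alternates along a
  component, so that the alternating sum of the cusps is a plain sum of weights. *)
Definition cusp_weight (d : dart w) : int :=
  if site d is Some (x, out)
  then if oriented S x.1 then 0%R else (eps (~~ out) * eps (x.2 == x.1.2))%R
  else 0%R.

Lemma site_smooth (d : dart w) x out : site d = Some (x, out) ->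
  site (smooth S d) = Some (mate x, if oriented S x.1 then ~~ out else out).
Proof.
move=> e; have [xw _] := site_inv e.
by rewrite /smooth e site_dart_at // mate_in.
Qed.

Lemma smooth_None (d : dart w) : site d = None -> smooth S d = d.
Proof. by rewrite /smooth => ->. Qed.

Lemma smoothK : involutive (@smooth w S).
Proof.
move=> d; case e: (site d) => [[x out]|]; last by rewrite !smooth_None.
have [_ ed] := site_inv e; have e' := site_smooth e.
rewrite {1}/smooth e' mateK -[(mate x).1]/(x.1) -[RHS]ed.
by case: (oriented S x.1); rewrite ?negbK.
Qed.

Lemma smooth_ne (d : dart w) : (smooth S d != d) = (site d != None).
Proof.
case e: (site d) => [[x out]|]; last by rewrite smooth_None // eqxx.
apply/eqP => h; have := site_smooth e; rewrite h e => -[].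
by case: (x) => c [].
Qed.

Lemma cusp_weight_smooth (d : dart w) :
  cusp_weight (smooth S d) = (- cusp_weight d)%R.
Proof.
case e: (site d) => [[x out]|].
  rewrite /cusp_weight (site_smooth e) e /=.
  case: (oriented S x.1) => //=.
  by case: x {e} => -[n s] b; case: b; case: s; case: out.
by rewrite smooth_None // /cusp_weight e oppr0.
Qed.

(** Positive when the walk leaving from [d] follows the orientation of the diagram. *)
Definition heading (d : dart w) : int := eps (~~ d.2).

Lemma site_out (d : dart w) x out : site d = Some (x, out) -> out = ~~ d.2.
Proof. by case/site_inv => _ <-; case: out. Qed.

Lemma cusp_Some d b : cusp S d = Some b ->
  cusp_weight (opp d) = (heading d * eps b)%R /\
  heading (advance S d) = (- heading d)%R.
Proof.
rewrite /cusp /cusp_weight /advance /heading.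
case e: (site (opp d)) => [[x out]|] //.
have eo := site_out e; have := site_out (site_smooth e).
case: (oriented S x.1) => //= eo' [<-].
by rewrite -eo' eo /= negbK; split=> //; case: (d.2).
Qed.

Lemma cusp_None d : cusp S d = None -> site (opp d) != None ->
  cusp_weight (opp d) = 0%R /\ heading (advance S d) = heading d.
Proof.
rewrite /cusp /cusp_weight /advance /heading.
case e: (site (opp d)) => [[x out]|] //.
have eo := site_out e; have := site_out (site_smooth e).
case: (oriented S x.1) => //= eo' _ _.
by rewrite -eo' eo /= negbK.
Qed.

(** The heading flips at cusps and nowhere else, which turns the alternating signs into those built
    into [cusp_weight]. The last position is exempt from the hypothesis: there the long component
    arrives at the head, with no cusp and weight 0. *)
Lemma alt_sum_traject d n :
  (forall i, i.+1 < n -> site (opp (iter i (advance S) d)) != None) ->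
  alt_sum (pmap (cusp S) (traject (advance S) d n)) =
  (heading d * \sum_(i < n) cusp_weight (opp (iter i (advance S) d)))%R.
Proof.
elim: n d => [|n IH] d h; first by rewrite big_ord0 mulr0.
have {}IH := IH (advance S d).
rewrite big_ord_recl /=.
have hs (F : dart w -> int) : (\sum_(i < n) F (iter (bump 0 i) (advance S) d) =
    \sum_(i < n) F (iter i (advance S) (advance S d)))%R.
  by apply: eq_bigr => i _; rewrite /bump /= -iterSr.
rewrite (hs (fun x => cusp_weight (opp x))).
have {}IH : alt_sum (pmap (cusp S) (traject (advance S) (advance S d) n)) =
  (heading (advance S d) * \sum_(i < n) cusp_weight (opp (iter i (advance S) (advance S d))))%R.
  by apply: IH => i lt; rewrite -iterSr; apply: h.
case e: (cusp S d) => [b|] /=.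
  have [h1 h2] := cusp_Some e; rewrite IH h1 h2 /heading.
  by move: (\sum_(_ < n) _)%R => X; case: (~~ d.2); rewrite /eps; case: (b); lia.
case: n h IH {hs} => [|n] h IH.
  rewrite big_ord0 /= addr0; move: e; rewrite /cusp /cusp_weight.
  case: (site _) => [[x out]|]; last by rewrite mulr0.
  by case: ifP => //; rewrite mulr0.
have [h1 h2] := cusp_None e (h 0 isT); by rewrite IH h1 h2 add0r.
Qed.

End State.
End Darts.

(* The end [(Some x, out)] is the half-strand at the passage [x]; the tail is
  [(None, true)] and the head is [(None, false)]. *)
Definition pend : Type := (option passage * bool)%type.

Fixpoint seg (p : option passage) (s : gcode) (q : option passage) :
    seq (pend * pend * int) :=
  if s is x :: s' then ((p, true), (Some x, false), 0%R) :: seg (Some x) s' q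
  else [:: ((p, true), (q, false), 0%R)].

Definition strand_arcs (w : gcode) := seg None w None.

(** The weights are the values of [cusp_weight] at the first end of each arc. *)
Definition crossing_arcs (c : crossing) (A : bool) : seq (pend * pend * int) :=
  let over := Some (c, true) in let under := Some (c, false) in
  if A == c.2
  then [:: ((over, false), (under, true), 0%R); ((over, true), (under, false), 0%R)]
  else [:: ((over, false), (under, false), eps c.2);
           ((over, true), (under, true), (- eps c.2)%R)].

Fixpoint states (cs : seq crossing) : seq (int * seq (pend * pend * int)) :=
  if cs is c :: cs' then
    [seq ((st.1 + 1)%R, crossing_arcs c true ++ st.2) | st <- states cs'] ++
    [seq ((st.1 - 1)%R, crossing_arcs c false ++ st.2) | st <- states cs']
  else [:: (0%R, [::])].

Definition delta : laurent := (- varA ^+ 2 - varA ^- 2)%R.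

(** One factor [delta] per circular component: the exponent in the arrow polynomial is the number of
    components minus one, the long one being left out. Halving turns a number of cusps into the
    index of the variable. *)
Definition loop_value (n : nat) : arrow_ring := (delta *: Kvar n./2)%R.

Definition value (R : comNzRingType) (kap lng : nat -> R) (m : pend -> pend * int) gl : R :=
  let r := run m gl in
  (lng `|(r.1 (None, true)).2|%N * \prod_(l <- r.2) kap l)%R.

Definition smoothing (cs : seq crossing) (S : {fset crossing}) :=
  flatten [seq crossing_arcs c (c \in S) | c <- cs].

Lemma mem_ends_crossing c A (e : pend) :
  (e \in ends (crossing_arcs c A)) = (if e.1 is Some x then x.1 == c else false).
Proof.
case: e => [[[c' l]|] o]; rewrite /crossing_arcs; case: (A == c.2) => //=;
  rewrite !inE !xpair_eqE !(inj_eq Some_inj) !xpair_eqE;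
  by case: (c' == c); case: l; case: o.
Qed.

Lemma mem_ends_smoothing cs S (e : pend) :
  (e \in ends (smoothing cs S)) = (if e.1 is Some x then x.1 \in cs else false).
Proof.
elim: cs => [|c cs IH] /=; first by case: e.1.
rewrite ends_cat mem_cat mem_ends_crossing IH.
by case: e.1 => //= x; rewrite inE.
Qed.

Lemma uniq_crossing c A : uniq (ends (crossing_arcs c A)).
Proof.
by rewrite /crossing_arcs; case: (A == c.2);
  rewrite /= !inE !xpair_eqE !(inj_eq Some_inj) !xpair_eqE !andbF.
Qed.

Lemma uniq_smoothing cs S : uniq cs -> uniq (ends (smoothing cs S)).
Proof.
elim: cs => [|c cs IH] //= /andP[cn U].
rewrite ends_cat cat_uniq uniq_crossing IH // andbT /=.
apply/hasPn => e; rewrite mem_ends_smoothing mem_ends_crossing.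
by case: e.1 => //= x xs; apply: contraNneq cn => <-.
Qed.

Lemma size_seg p s q : size (seg p s q) = (size s).+1.
Proof. by elim: s p => //= x s IH p; rewrite IH. Qed.

Lemma nth_seg z p s q i : i <= size s ->
  nth z (seg p s q) i =
  ((nth p (p :: map Some s) i, true), (nth q (map Some s) i, false), 0%R).
Proof.
elim: s p i => [|x s IH] p [|i] //= le; rewrite IH //=.
case: i le => //= i le; rewrite (set_nth_default p) //.
by rewrite size_map.
Qed.

Lemma scale_prod (R : comNzRingType) (A : comAlgType R) (I : finType) (P : pred I)
    (c : R) (F : I -> A) :
  (c ^+ #|P| *: (\prod_(i | P i) F i) = \prod_(i | P i) (c *: F i))%R.
Proof. by rewrite scaler_prod prodr_const. Qed.

Arguments dart_at : simpl never.

(** * Comparison of the walk on darts with splices of named ends *)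

Section Bridge.
Variables (w : gcode) (S : {fset crossing}) (cs : seq crossing).
Hypotheses (wg : gauss w) (csU : uniq cs) (csE : cs =i crossings w).

Let wU : uniq w. Proof. by case/andP: wg. Qed.

Definition name_end (d : dart w) : pend :=
  if site d is Some (x, out) then (Some x, out) else (None, ~~ d.2).

Lemma name_end_inj : injective name_end.
Proof.
move=> d d'; rewrite /name_end.
case e: (site d) => [[x o]|]; case e': (site d') => [[x' o']|] //.
  by move=> -[xx oo]; rewrite xx oo in e; case: (site_inv wg e) => _ <-;
    case: (site_inv wg e') => _ <-.
by case: (site_None e) => ->; case: (site_None e') => ->.
Qed.

Lemma name_end_dart_at x out : x \in w -> name_end (dart_at w x out) = (Some x, out).
Proof. by move=> xw; rewrite /name_end site_dart_at. Qed.

Definition edges : seq (dart w * dart w * int) :=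
  [seq ((e, false), (e, true), 0%R) | e <- enum 'I_(size w).+1].

Lemma strand_arcs_edges : strand_arcs w = map (relabel name_end) edges.
Proof.
have z : pend * pend * int := ((None, true), (None, true), 0%R).
apply: (@eq_from_nth _ z).
  by rewrite size_seg /edges size_map size_map size_enum_ord.
move=> i; rewrite size_seg => lt; rewrite /strand_arcs nth_seg //.
rewrite (nth_map ((ord0, false), (ord0, false), 0%R)); last first.
  by rewrite size_map size_enum_ord.
rewrite (nth_map ord0) ?size_enum_ord // /relabel /name_end /=.
have -> : nth ord0 (enum 'I_(size w).+1) i = Ordinal lt.
  by apply: val_inj; rewrite /= nth_enum_ord.
congr (_, _, _).
  case: i lt => [|i] lt //; rewrite /site /= onthE /=.
  by case: (nth _ _ _).
by rewrite /site /= onthE; case: (nth _ _ _).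
Qed.

Lemma ends_edges_uniq : uniq (ends edges).
Proof.
have -> : ends edges = [seq (e, b) | e <- enum 'I_(size w).+1, b <- [:: false; true]].
  by rewrite /ends /edges -map_comp.
by apply: allpairs_uniq; rewrite ?enum_uniq // => -[? ?] [? ?].
Qed.

Lemma lookup_strand d : lookup (strand_arcs w) (name_end d) = (name_end (opp d), 0%R).
Proof.
rewrite strand_arcs_edges (lookup_relabel name_end_inj).
case: d => e b; have h : ((e, false), (e, true), 0%R) \in edges by apply/map_f/mem_enum.
by have [e1 e2] := lookup_in ends_edges_uniq h; case: b; rewrite ?e1 ?e2 //= oppr0.
Qed.

Definition dart_arcs (c : crossing) (A : bool) : seq (dart w * dart w * int) :=
  let at_ l out := dart_at w (c, l) out in
  if A == c.2
  then [:: (at_ true false, at_ false true, 0%R); (at_ true true, at_ false false, 0%R)]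
  else [:: (at_ true false, at_ false false, eps c.2);
           (at_ true true, at_ false true, (- eps c.2)%R)].

Definition dart_smoothing := flatten [seq dart_arcs c (c \in S) | c <- cs].

Lemma passage_in c l : c \in cs -> (c, l) \in w.
Proof.
rewrite csE => /imfsetP[[c' l'] /= xw ->].
case: (eqVneq l l') => [-> //|ne]; rewrite -(mate_in wg).
by rewrite /mate /=; case: l ne; case: l' xw.
Qed.

Lemma relabel_smoothing : map (relabel name_end) dart_smoothing = smoothing cs S.
Proof.
rewrite map_flatten -map_comp /smoothing; congr flatten; apply/eq_in_map => c cc /=.
rewrite /dart_arcs /crossing_arcs; case: (_ == _);
  by rewrite /= /relabel /= !name_end_dart_at ?passage_in.
Qed.

Lemma uniq_dart_smoothing : uniq (ends dart_smoothing).
Proof.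
by rewrite -(map_inj_uniq name_end_inj) -ends_relabel relabel_smoothing uniq_smoothing.
Qed.

Lemma mem_dart_smoothing d : (d \in ends dart_smoothing) = (smooth S d != d).
Proof.
rewrite smooth_ne // -(mem_map name_end_inj) -ends_relabel relabel_smoothing.
rewrite mem_ends_smoothing /name_end; case e: (site d) => [[[c l] o]|] //=.
by rewrite csE; apply/imfsetP; exists (c, l) => //=; case: (site_inv wg e).
Qed.

Lemma dart_smoothing_smooth a b t : (a, b, t) \in dart_smoothing ->
  b = smooth S a /\ t = cusp_weight S a.
Proof.
case/flattenP => s /mapP[c cc ->].
have cw l : (c, l) \in w by exact: passage_in.
rewrite /smooth /cusp_weight /dart_arcs /oriented.
by case: ifP => h; rewrite !inE => /orP[]/eqP[-> -> ->];
  rewrite !site_dart_at //= h /mate /eps /=; split=> //; case: (c.2).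
Qed.

Let adv := advance (w := w) S.
Let lk := linked (w := w) S.

Let qK := @smoothK w wg S.
Let oK := @oppK w.

Lemma run_strand :
  let r := run (lookup (strand_arcs w)) (smoothing cs S) in
  let r' := run (fun d : dart w => (opp d, 0%R)) dart_smoothing in
  r.2 = r'.2 /\ (r.1 (None, true)).2 = (r'.1 (tail_dart w)).2.
Proof.
have [] := @run_relabel _ _ _ name_end_inj (fun d : dart w => (opp d, 0%R))
  (lookup (strand_arcs w)) dart_smoothing lookup_strand.
by rewrite relabel_smoothing => e1 e2; split=> //=; rewrite (e2 (tail_dart w)).
Qed.

Lemma smooth_fixed (d : dart w) : smooth S d = d -> d = tail_dart w \/ d = head_dart w.
Proof.
by move=> h; apply: site_None; apply/eqP; have := smooth_ne wg S d; rewrite h eqxx; case: eqP.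
Qed.

(** Identifies the arc that the splices leave at the tail with the stretch of the walk over which
    [long_cusps] is computed. *)
Lemma long_path : exists n,
  [/\ iter n.+1 adv (tail_dart w) = head_dart w,
      forall i, 0 < i <= n -> smooth S (iter i adv (tail_dart w)) != iter i adv (tail_dart w),
      n.+1 < fingraph.order adv (tail_dart w),
      size (cancel_cusps (long_cusps w S)) =
        `|(\sum_(i < n.+1) cusp_weight S (opp (iter i adv (tail_dart w))))%R|%N
    & (\sum_(i < n.+1) cusp_weight S (opp (iter i adv (tail_dart w))))%R =
      ((run (lookup (strand_arcs w)) (smoothing cs S)).1 (None, true)).2].
Proof.
have [_ e2] := run_strand; rewrite e2.
have [_ long] := run_components oK qK (@opp_ne w) (cusp_weight_smooth wg S)
  (fun=> 1%R : int) uniq_dart_smoothing dart_smoothing_smooth mem_dart_smoothing.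
have [n []] := long (tail_dart w) (smooth_None S (site_tail w)).
set y := (_.1); move=> en dn fy yt sn.
have {fy} ey : y = head_dart w by case: (smooth_fixed fy) yt => // ->; rewrite eqxx.
rewrite ey in en.
have ad_inj : injective adv by exact: (walk_inj oK qK).
have fc : fconnect adv (tail_dart w) (head_dart w) by rewrite -en fconnect_iter.
(* The head cannot be met earlier, since [smooth] fixes it and fixes no intermediate position, nor
   can its first occurrence be later than step [n.+1]. *)
have fi : findex adv (tail_dart w) (head_dart w) = n.+1.
  case: (ltngtP (findex adv (tail_dart w) (head_dart w)) n.+1) => // lt.
    have := iter_findex fc; case: (findex _ _ _) lt => [|i] lt /=.
      by move=> e; have := tail_head w; rewrite e eqxx.
    have := dn i.+1; rewrite /= -/(iter _ _ _) => /(_ lt) + e.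
    by rewrite -[walk _ _ _]/(adv (iter i adv _)) e smooth_None ?eqxx // site_head.
  have := findex_iter (ltn_trans lt (findex_max fc)); rewrite -[iter _ _ _]/(iter _ (walk _ _) _).
  by rewrite en => e; rewrite e ltnn in lt.
exists n; split=> //; first by rewrite -fi findex_max.
rewrite size_cancel_cusps /long_cusps -/adv fi alt_sum_traject //; first by rewrite /heading /= mul1r.
move=> i lt; apply/negP => /eqP si.
have := dn i.+1; rewrite ltnS in lt; rewrite lt => /(_ isT).
by rewrite /= /walk [smooth _ _]smooth_None // smooth_None // eqxx.
Qed.

Lemma long_component (kap : nat -> arrow_ring) :
  let r := run (lookup (strand_arcs w)) (smoothing cs S) in
  [/\ (\prod_(l <- r.2) kap l = \prod_(d | fingraph.roots lk d &&
        no_end (@opp w) (smooth S) d) kap (hol (@opp w) (smooth S) (cusp_weight S) d))%R,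
      connect lk (tail_dart w) (head_dart w)
    & size (cancel_cusps (long_cusps w S)) = `|(r.1 (None, true)).2|%N].
Proof.
have [n [en _ _ sn e2]] := long_path; have [e1 _] := run_strand; rewrite /= e1.
have [-> _] := run_components oK qK (@opp_ne w) (cusp_weight_smooth wg S) kap
  uniq_dart_smoothing dart_smoothing_smooth mem_dart_smoothing.
split=> //; last by rewrite sn e2.
rewrite -en; exact: connect_walk.
Qed.

Lemma linked_sym : connect_sym lk.
Proof. exact: (connect_joined_sym oK qK). Qed.

Lemma no_end_tail (d : dart w) : connect lk (tail_dart w) (head_dart w) ->
  no_end (@opp w) (smooth S) d = ~~ connect lk (tail_dart w) d.
Proof.
move=> th; congr (~~ _); apply/existsP/idP => [[y /andP[dy /eqP/smooth_fixed]]|td].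
  case=> e; first by rewrite -e linked_sym.
  by apply: connect_trans th _; rewrite -e linked_sym.
by exists (tail_dart w); rewrite smooth_None // eqxx andbT -[connect _ _ _]/(connect lk _ _) linked_sym.
Qed.

Lemma loop_cusps_hol d : ~~ connect lk (tail_dart w) d ->
  connect lk (tail_dart w) (head_dart w) ->
  size (cancel_cusps (loop_cusps S d)) = hol (@opp w) (smooth S) (cusp_weight S) d.
Proof.
move=> td th; rewrite size_cancel_cusps /loop_cusps /orbit alt_sum_traject //.
  rewrite hol_order.
  rewrite /heading; case: (~~ d.2); rewrite /eps ?mul1r // mulN1r abszN //.
move=> i _; apply/negP => /eqP e.
have c : connect lk d (opp (iter i adv d)).
  apply: connect_trans (connect_walk _ _ i d) _.
  by apply: connect1; rewrite /lk /linked /joined /= eqxx.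
move: td; rewrite linked_sym; case/site_None: e => e; rewrite e in c; first by rewrite c.
by rewrite (connect_trans c) // linked_sym.
Qed.

Lemma state_value :
  (delta ^+ (n_components w S).-1 *: state_vars w S =
   value loop_value (fun n => Lvar n./2) (lookup (strand_arcs w)) (smoothing cs S))%R.
Proof.
have [h1 h2 h3] := long_component loop_value.
rewrite /value h1 /state_vars /half_surviving h3 scalerAr; congr (_ * _)%R.
have rl d : (d \in loops w S) = fingraph.roots lk d && no_end (@opp w) (smooth S) d.
  by rewrite inE no_end_tail.
rewrite (eq_bigr (fun d => Kvar (hol (@opp w) (smooth S) (cusp_weight S) d)./2)); last first.
  by move=> d; rewrite inE => /andP[_ dn]; rewrite loop_cusps_hol.
rewrite (eq_bigl _ _ rl).
(* The predecessor removes the root of the component of the tail, which is the only one with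
   ends. *)
have -> : (n_components w S).-1 =
    #|[pred d | fingraph.roots lk d && no_end (@opp w) (smooth S) d]|.
  rewrite /n_components /n_comp_mem.
  rewrite (cardD1 (fingraph.root lk (tail_dart w))) !inE roots_root ?linked_sym //=; last exact: linked_sym.
  apply: eq_card => d; rewrite !inE andbT andbC.
  rewrite no_end_tail //.
  case: (boolP (fingraph.roots lk d)) => //= /eqP rd; congr (~~ _).
  rewrite -[d in LHS]rd (root_connect linked_sym) linked_sym.
  by [].
exact: scale_prod.
Qed.

End Bridge.

Lemma varA_neq0 : varA != 0%R.
Proof. by rewrite tofrac_eq0 polyX_eq0. Qed.

Lemma sum_fpowersetU1 (K : choiceType) (R : nmodType) (c : K) (X : {fset K})
    (F : {fset K} -> R) : c \notin X ->
  (\sum_(S <- fpowerset (c |` X)%fset) F S =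
   \sum_(S <- fpowerset X) F (c |` S)%fset + \sum_(S <- fpowerset X) F S)%R.
Proof.
move=> cX.
have notin S : S \in fpowerset X -> c \notin S.
  by rewrite fpowersetE => /fsubsetP SX; apply: contra cX => /SX.
rewrite (perm_big ([seq (c |` Y)%fset | Y <- fpowerset X] ++ fpowerset X)) /=.
  by rewrite big_cat big_map.
apply: uniq_perm; first exact: fset_uniq.
  rewrite cat_uniq fset_uniq andbT map_inj_in_uniq ?fset_uniq /=.
    apply/hasPn => S /notin cS; apply: contra cS => /mapP[S' _ ->].
    by rewrite !inE eqxx.
  move=> S S' /notin cS /notin cS' /(congr1 (fun Y => Y `\ c)%fset).
  by rewrite !fsetU1K.
move=> S; rewrite mem_cat !fpowersetE; apply/idP/orP.
  move=> h; case: (boolP (c \in S)) => cS; [left|right].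
    apply/mapP; exists (S `\ c)%fset; last by rewrite fsetD1K.
    by rewrite fpowersetE fsubDset.
  apply/fsubsetP => x xS; have /fsubsetP/(_ _ xS) := h.
  by rewrite !inE => /orP[/eqP e|//]; rewrite -e xS in cS.
case=> [/mapP[S' S'X ->]|h]; last exact: fsubset_trans h (fsubsetU1 _ _).
by rewrite fsetUS // -fpowersetE.
Qed.

(** Replaces subsets by a list that computes and splits along a concatenation of crossings. Putting
    a crossing into [S] raises the exponent by one, leaving it out lowers it by one. *)
Lemma sum_states (K : fieldType) (R : lmodType K) (A : K) (cs : seq crossing)
    (F : seq (pend * pend * int) -> R) : A != 0%R -> uniq cs ->
  (\sum_(S <- fpowerset [fset c in cs]%fset)
     A ^ (#|` S|%:Z - #|` ([fset c in cs] `\` S)%fset|%:Z) *: F (smoothing cs S) =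
   \sum_(st <- states cs) A ^ st.1 *: F st.2)%R.
Proof.
move=> A0; elim: cs F => [|c cs IH] F /=.
  move=> _; rewrite (_ : [fset c in [::]]%fset = fset0); last by apply/fsetP => x; rewrite !inE.
  rewrite fpowerset0 big_seq_fset1 big_seq1 /smoothing /= fset0D cardfs0 subrr.
  by [].
case/andP => cn U.
set X := [fset c in cs]%fset in IH *.
have cX : c \notin X by rewrite !inE.
have -> : [fset c' in c :: cs]%fset = (c |` X)%fset.
  by apply/fsetP => x; rewrite !inE.
have inX S : S \in fpowerset X -> (c \notin S) * (S `<=` X)%fset.
  by rewrite fpowersetE => SX; split=> //; apply: contra cX; apply/fsubsetP.
rewrite sum_fpowersetU1 // big_cat !big_map /=.
have IH' b := IH (fun g => F (crossing_arcs c b ++ g)) U.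
congr (_ + _)%R.
  transitivity (\sum_(st <- states cs) A *: (A ^ st.1 *: F (crossing_arcs c true ++ st.2)))%R.
    rewrite -scaler_sumr -IH' scaler_sumr; apply: eq_big_seq => S SX.
    have [cS sub] := inX _ SX.
    rewrite scalerA -{2}[A]expr1z -expfzDr ?A0 //; congr (_ ^ _ *: F _)%R.
      have -> : ((c |` X) `\` (c |` S) = X `\` S)%fset.
        apply/fsetP => x; rewrite !inE; case: (eqVneq x c) => [->|] //=.
        by rewrite (negbTE cn) andbF.
      by rewrite cardfsU1 cS PoszD -addrA.
    rewrite /smoothing /= !inE eqxx /=; congr (_ ++ flatten _); apply/eq_in_map => c' cc.
    by rewrite !inE; case: eqP cc => [->|//]; rewrite (negbTE cn).
  by apply: eq_bigr => st _; rewrite scalerA -{1}[A]expr1z -expfzDr ?A0 // addrC.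
transitivity (\sum_(st <- states cs) A^-1 *: (A ^ st.1 *: F (crossing_arcs c false ++ st.2)))%R.
  rewrite -scaler_sumr -IH' scaler_sumr; apply: eq_big_seq => S SX.
  have [cS sub] := inX _ SX.
  rewrite scalerA -exprN1 -expfzDr ?A0 //.
  congr (_ ^ _ *: F _)%R.
    have -> : ((c |` X) `\` S = c |` (X `\` S))%fset.
      apply/fsetP => x; rewrite !inE; case: (eqVneq x c) => [->|] //=.
      by rewrite cS.
    rewrite cardfsU1 !inE (negbTE cn) andbF.
    by rewrite PoszD opprD addrCA.
  by rewrite /smoothing /= (negbTE cS).
apply: eq_bigr => st _; rewrite scalerA -exprN1.
by rewrite -expfzDr ?A0 // addrC.
Qed.

Definition state_sum (K : fieldType) (R : comAlgType K) (A : K) (kap lng : nat -> R)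
    (w : gcode) (cs : seq crossing) : R :=
  (\sum_(st <- states cs) A ^ st.1 *: value kap lng (lookup (strand_arcs w)) st.2)%R.

Lemma arrow_state_sum w cs : gauss w -> uniq cs -> cs =i crossings w ->
  arrow_polynomial w = state_sum varA loop_value (fun n => Lvar n./2) w cs.
Proof.
move=> wg U csE; rewrite /arrow_polynomial.
have -> : crossings w = [fset c in cs]%fset by apply/fsetP => c; rewrite inE csE.
rewrite /state_sum -(sum_states _ varA_neq0 U).
apply: eq_bigr => S _.
by rewrite -(state_value S wg U csE) scalerA.
Qed.

(** * Local moves *)

Section Moves.
Variables (K : fieldType) (R : comAlgType K) (A : K) (kap lng : nat -> R).

Local Notation value := (value kap lng).
Local Notation state_sum := (state_sum A kap lng).

Lemma value_perm m gl gl' : wired m gl -> perm_eq gl gl' -> value m gl = value m gl'.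
Proof.
by move=> h p; have [e1 e2] := run_perm h p; rewrite /value e1 (perm_big _ e2).
Qed.

Lemma value_cat m g1 g2 :
  value m (g1 ++ g2) = ((\prod_(l <- (run m g1).2) kap l) * value (run m g1).1 g2)%R.
Proof. by rewrite /value run_cat /= big_cat mulrCA. Qed.

Lemma value_agree (P : pred pend) m1 m2 gl :
  (forall x, x \in P -> m1 x = m2 x) ->
  (forall x, x \in P -> (m1 x).1 \in P) -> {subset ends gl <= P} ->
  (None, true) \in P -> value m1 gl = value m2 gl.
Proof.
by move=> h1 h2 h3 h4; have [e1 e2 _] := run_agree h1 h2 h3; rewrite /value e1 e2.
Qed.

Lemma value_ext m1 m2 gl : m1 =1 m2 -> value m1 gl = value m2 gl.
Proof. by move=> h; apply: (@value_agree predT) => // x _; rewrite h. Qed.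

Section Rename.
Variable f : crossing -> crossing.
Hypotheses (f_inj : injective f) (f_sign : forall c, (f c).2 = c.2).

Definition rename (x : passage) : passage := (f x.1, x.2).
Definition rename_end (e : pend) : pend := (omap rename e.1, e.2).

Lemma rename_inj : injective rename.
Proof. by case=> c l [c' l'] [] /f_inj -> ->. Qed.

Lemma rename_end_inj : injective rename_end.
Proof.
case=> p o [p' o'] [h ->]; congr (_, _).
by case: p p' h => [x|] [y|] //= h; congr Some; apply: rename_inj; case: h => h1 h2; rewrite /rename h1 h2.
Qed.

Lemma seg_rename p s q :
  seg (omap rename p) (map rename s) (omap rename q) =
  map (relabel rename_end) (seg p s q).
Proof. by elim: s p => [|x s IH] p //=; rewrite -[Some (rename x)]/(omap rename (Some x)) IH. Qed.

Lemma crossing_arcs_rename c b :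
  crossing_arcs (f c) b = map (relabel rename_end) (crossing_arcs c b).
Proof. by rewrite /crossing_arcs f_sign; case: (_ == _). Qed.

Lemma states_rename cs :
  states (map f cs) = [seq (st.1, map (relabel rename_end) st.2) | st <- states cs].
Proof.
elim: cs => //= c cs ->; rewrite map_cat -!map_comp.
by congr (_ ++ _); apply: eq_map => st /=; rewrite crossing_arcs_rename map_cat.
Qed.

Lemma state_sum_rename w cs : state_sum (map rename w) (map f cs) = state_sum w cs.
Proof.
rewrite /state_sum states_rename big_map; apply: eq_bigr => st _; congr (_ *: _)%R.
have [e1 e2] := run_relabel rename_end_inj st.2
  (fun x => lookup_relabel rename_end_inj (strand_arcs w) x).
rewrite /strand_arcs -(seg_rename None w None) in e1 e2.
by rewrite /value e1 -[(None, true)]/(rename_end (None, true)) e2.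
Qed.

End Rename.

Lemma perm_ends_seg p s q :
  perm_eq (ends (seg p s q))
    ((p, true) :: (q, false) :: flatten [seq [:: (Some x, false); (Some x, true)] | x <- s]).
Proof.
elim: s p => [|x s IH] p //=; rewrite perm_cons.
apply: (@perm_trans _ ((Some x, false) :: (Some x, true) :: (q, false) ::
  flatten [seq [:: (Some x, false); (Some x, true)] | x <- s])).
  by rewrite perm_cons; apply: IH.
by apply/permPl; apply: (perm_catCA [:: _; _] [:: _]).
Qed.

Lemma mem_both_ends w (e : pend) :
  (e \in flatten [seq [:: (Some x, false); (Some x, true)] | x <- w]) =
  (if e.1 is Some x then x \in w else false).
Proof.
apply/flattenP/idP => [[s /mapP[x xw ->]]|].
  by rewrite !inE => /orP[]/eqP->.
case: e => [[x|] o] //= xw; exists [:: (Some x, false); (Some x, true)].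
  by apply/mapP; exists x.
by rewrite !inE; case: o; rewrite eqxx ?orbT.
Qed.

Lemma mem_ends_strand w (e : pend) :
  (e \in ends (strand_arcs w)) = (if e.1 is Some x then x \in w else true).
Proof.
rewrite (perm_mem (perm_ends_seg None w None)) !inE.
have h := mem_both_ends w e.
by rewrite h; case: e {h} => [[x|] []].
Qed.

Lemma uniq_ends_strand w : uniq w -> uniq (ends (strand_arcs w)).
Proof.
move=> U; rewrite (perm_uniq (perm_ends_seg None w None)) /= inE /=.
have mem o : (None, o) \in flatten [seq [:: (Some x, false); (Some x, true)] | x <- w] = false.
  by apply/flattenP => -[s /mapP[x xw ->]]; rewrite !inE.
rewrite !mem /=; have -> : flatten [seq [:: (Some x, false); (Some x, true)] | x <- w] =
  [seq (Some x, b) | x <- w, b <- [:: false; true]] by [].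
by apply: allpairs_uniq => // -[x b] [y b'] _ _ [-> ->].
Qed.

Lemma seg_cat p u x v q :
  seg p (u ++ x :: v) q = seg p u (Some x) ++ seg (Some x) v q.
Proof. by elim: u p => //= y u IH p; rewrite IH. Qed.

Lemma seg_remove p u x v q : exists a b B,
  perm_eq (seg p (u ++ x :: v) q)
    ((a, (Some x, false), 0%R) :: ((Some x, true), b, 0%R) :: B) /\
  perm_eq (seg p (u ++ v) q) ((a, b, 0%R) :: B).
Proof.
elim: u p => [|y u IH] p /=.
  case: v => [|z v]; first by exists (p, true), (q, false), [::].
  by exists (p, true), (Some z, false), (seg (Some z) v q).
have [a [b [B [h1 h2]]]] := IH (Some y).
exists a, b, (((p, true), (Some y, false), 0%R) :: B); split.
  apply: (@perm_trans _ (((p, true), (Some y, false), 0%R) ::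
    (a, (Some x, false), 0%R) :: ((Some x, true), b, 0%R) :: B)).
    by rewrite perm_cons.
  by apply/permPl; apply: (perm_catCA [:: _] [:: _; _]).
apply: (@perm_trans _ (((p, true), (Some y, false), 0%R) :: (a, b, 0%R) :: B)).
  by rewrite perm_cons.
by apply/permPl; apply: (perm_catCA [:: _] [:: _]).
Qed.

(** Goes straight through a dummy passage. Splicing it merely undoes the subdivision of an edge, so
    dummies can be inserted without changing the value of a state. *)
Definition pad_arc (x : passage) : pend * pend * int := ((Some x, false), (Some x, true), 0%R).

Lemma mem_ends_pads Ns (e : pend) :
  (e \in ends (map pad_arc Ns)) = (if e.1 is Some x then x \in Ns else false).
Proof. by rewrite /ends -map_comp; apply: mem_both_ends. Qed.

Lemma value_pad u x v gl : uniq (u ++ x :: v) ->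
  (forall e, e \in ends gl -> e.1 != Some x) ->
  value (lookup (strand_arcs (u ++ x :: v))) (pad_arc x :: gl) =
  value (lookup (strand_arcs (u ++ v))) gl.
Proof.
move=> U glx.
have [a [b [B [h1 h2]]]] := seg_remove None u x v None.
have U1 := uniq_ends_strand U.
have U' : uniq (u ++ v).
  by move: U; rewrite -cat1s uniq_catCA /= => /andP[].
have U2 := uniq_ends_strand U'.
have xn : x \notin u ++ v by move: U; rewrite -cat1s uniq_catCA /= => /andP[].
set L := _ :: B in h2; set L0 := [:: _, _ & B] in h1.
have m1 := lookup_perm U1 h1; have m2 := lookup_perm U2 h2.
rewrite (value_ext _ m2).
have UL0 : uniq (ends L0) by rewrite -(perm_uniq (perm_ends h1)).
have UL : uniq (ends L) by rewrite -(perm_uniq (perm_ends h2)).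
have [ax xa] := lookup_in (L := L0) UL0 (mem_head _ _).
have yL0 : ((Some x, true), b, 0%R) \in L0 by rewrite !inE eqxx orbT.
have [yb by_] := lookup_in UL0 yL0.
have nL : (Some x, false) \notin ends L /\ (Some x, true) \notin ends L.
  by rewrite -!(perm_mem (perm_ends h2)) !mem_ends_strand.
case: nL => nx ny.
have ab : a != b by move: UL => /= /andP[]; rewrite inE negb_or => /andP[].
have xa' : (Some x, false) != a :> pend by apply: contraNneq nx => ->; rewrite /= inE eqxx.
have ya' : (Some x, true) != a :> pend by apply: contraNneq ny => ->; rewrite /= inE eqxx.
have xb' : (Some x, false) != b :> pend by apply: contraNneq nx => ->; rewrite /= !inE eqxx orbT.
have yb' : (Some x, true) != b :> pend by apply: contraNneq ny => ->; rewrite /= !inE eqxx orbT.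
have notB e : e \in ends B -> ((Some x, false) != e) * ((Some x, true) != e).
  by move=> eB; split; [apply: contraNneq nx|apply: contraNneq ny] => ->; rewrite /= !inE eB !orbT.
have key e : e.1 != Some x -> splice (lookup L0) (pad_arc x) e = lookup L e.
  move=> ex; rewrite /splice /pad_arc xa yb.
  have ex1 : e != (Some x, false) by apply: contraNneq ex => ->.
  have ex2 : e != (Some x, true) by apply: contraNneq ex => ->.
  rewrite (negbTE ex1) (negbTE ex2).
  have [la lb] := lookup_in UL (mem_head _ _).
  case: (eqVneq e a) => [->|ea]; first by rewrite ax la /= eqxx /shift /= !addr0.
  case: (eqVneq e b) => [->|eb].
    rewrite by_ lb /= xpair_eqE andbF eqxx /shift /=; congr (_, _); lia.
  rewrite /L0 /L /= (negbTE ea) (negbTE eb) (negbTE ex1) (negbTE ex2).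
  case: (boolP (e \in ends B)) => [eB|eB]; last by rewrite lookup_notin //= (negbTE ex1) (negbTE ex2).
  have [n1 n2] := notB _ (lookup_closed eB).
  by rewrite eq_sym (negbTE n1) eq_sym (negbTE n2).
have cl : (run (lookup (strand_arcs (u ++ x :: v))) [:: pad_arc x]).2 = [::].
  by rewrite /= /closes /= m1 xa /= eq_sym (negbTE ya').
rewrite [LHS](value_cat _ [:: pad_arc x] gl) cl big_nil mul1r.
apply: (@value_agree (fun e => e.1 != Some x)) => //.
  by move=> e ex; rewrite -key // /= /splice /pad_arc !m1.
move=> e ex.
have -> : (run (lookup (strand_arcs (u ++ x :: v))) [:: pad_arc x]).1 e = lookup L e.
  by rewrite -key // /= /splice /pad_arc !m1.
case: (boolP (e \in ends L)) => [/lookup_closed|n]; last by rewrite lookup_notin.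
rewrite -(perm_mem (perm_ends h2)) mem_ends_strand unfold_in.
by case: (_.1.1) => // y yw; apply: contraNneq xn => -[<-].
Qed.

Lemma value_pads Ns W gl : uniq W -> uniq Ns -> {subset Ns <= W} ->
  (forall e, e \in ends gl -> if e.1 is Some x then x \notin Ns else true) ->
  value (lookup (strand_arcs W)) (map pad_arc Ns ++ gl) =
  value (lookup (strand_arcs [seq x <- W | x \notin Ns])) gl.
Proof.
elim: Ns W => [|N Ns IH] W U; first by move=> *; rewrite filter_predT.
move=> /= /andP[nN UN] sub glN.
have NW : N \in W by apply: sub; rewrite inE eqxx.
case/path.splitPr: NW U sub => u v U sub.
have nuv : N \notin u ++ v by move: U; rewrite -cat1s uniq_catCA /= => /andP[].
have U' : uniq (u ++ v) by move: U; rewrite -cat1s uniq_catCA /= => /andP[].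
rewrite value_pad //; last first.
  move=> e; rewrite ends_cat mem_cat => /orP[|/glN].
    by rewrite mem_ends_pads; case: e.1 => // x xN; apply: contraNneq nN => -[<-].
  by case: e.1 => // x; apply: contra => /eqP[->]; rewrite inE eqxx.
rewrite IH //.
- congr (value (lookup (strand_arcs _)) _).
  rewrite !filter_cat /= inE eqxx /=; congr (_ ++ _); apply: eq_in_filter => x xs;
    rewrite inE negb_or; case: eqP => // e; by rewrite -e mem_cat xs ?orbT in nuv.
- move=> x xN; have := sub x; rewrite !inE xN orbT => /(_ isT).
  rewrite !mem_cat !inE; case: eqP => // e; by rewrite -e xN in nN.
- by move=> e /glN; case: e.1 => // x; rewrite inE negb_or => /andP[].
Qed.

End Moves.

(** * Computation with formal sums of tangle outcomes *)

Section FormalSums.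
Variable T : eqType.

Definition total (l : seq (T * int)) (k : T) : int :=
  foldr (fun i r => if i.1 == k then (i.2 + r)%R else r) 0%R l.

(** A boolean test on the finitely many keys that occur. It yields equality under every
    interpretation of the keys in an abelian group, in particular the one that glues a key to the
    outside of a tangle. *)
Definition same_sum (l1 l2 : seq (T * int)) : bool :=
  all (fun k => total l1 k == total l2 k) (map fst (l1 ++ l2)).

Lemma sum_total (V : zmodType) (G : T -> V) (ks : seq T) l :
  uniq ks -> {subset map fst l <= ks} ->
  (\sum_(i <- l) G i.1 *~ i.2 = \sum_(k <- ks) G k *~ total l k)%R.
Proof.
move=> U; elim: l => [|[k0 c] l IH] sub /=.
  by rewrite big_nil big1_seq // => k _; rewrite mulr0z.
rewrite big_cons IH => [|k kl]; last by apply: sub; rewrite inE kl orbT.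
have k0s : k0 \in ks by apply: sub; rewrite inE eqxx.
rewrite [in LHS](bigD1_seq k0) // [in RHS](bigD1_seq k0) //= eqxx addrA -mulrzDr.
congr (_ + _)%R; apply: eq_bigr => k; by rewrite eq_sym => /negbTE->.
Qed.

Lemma same_sumP (V : zmodType) (G : T -> V) l1 l2 : same_sum l1 l2 ->
  (\sum_(i <- l1) G i.1 *~ i.2 = \sum_(i <- l2) G i.1 *~ i.2)%R.
Proof.
move=> /allP h; set ks := undup (map fst (l1 ++ l2)).
rewrite !(@sum_total _ G ks) ?undup_uniq //; last first.
- by move=> k kl; rewrite mem_undup map_cat mem_cat kl ?orbT.
- by move=> k kl; rewrite mem_undup map_cat mem_cat kl ?orbT.
by apply: eq_big_seq => k; rewrite mem_undup => /h /eqP->.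
Qed.

End FormalSums.

(* Dummy passages, which isolate the three strands of a tangle; the crossings of
  the tangle are renamed to 0, 1 and 2. *)
Definition pad (i : nat) : passage := ((i.+3, true), true).

(** Each strand of the tangle runs from an even dummy passage to the next odd one; these are the
    half-strands of the dummies that face the tangle. *)
Definition boundary : seq pend :=
  [:: (Some (pad 0), true); (Some (pad 1), false); (Some (pad 2), true);
      (Some (pad 3), false); (Some (pad 4), true); (Some (pad 5), false)].

Definition inner_arcs (x y z : gcode) :=
  seg (Some (pad 0)) x (Some (pad 1)) ++ seg (Some (pad 2)) y (Some (pad 3)) ++
  seg (Some (pad 4)) z (Some (pad 5)).

(** Multiplies out the factors $-A^2-A^{-2}$ of [k] closed loops into pairs of an exponent and a
    coefficient, so that the checks handle integers only. *)
Fixpoint expand (k : nat) (e c : int) : seq (int * int) :=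
  if k is k'.+1 then expand k' (e + 2)%R (- c)%R ++ expand k' (e - 2)%R (- c)%R
  else [:: (e, c)].

Lemma mem_ends_inner x y z (e : pend) : (e \in ends (inner_arcs x y z)) =
  (e \in boundary) || (if e.1 is Some u then u \in x ++ y ++ z else false).
Proof.
rewrite /inner_arcs !ends_cat !mem_cat.
rewrite !(perm_mem (perm_ends_seg _ _ _)) !inE !mem_both_ends.
case: e.1 => [u|]; last by rewrite !orbF !orbA.
rewrite !mem_cat -!orbA; do 2!bool_congr.
by do ?[case: (u \in _); rewrite ?orbT ?orbF //=].
Qed.

Definition outcome (x y z : gcode) gl := run (lookup (inner_arcs x y z)) gl.

Definition key_of (r : (pend -> pend * int) * seq nat) : seq (pend * int) :=
  map r.1 boundary.

Definition tangle_terms (x y z : gcode) (cs : seq crossing) (e0 c0 : int) :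
    seq (seq (pend * int) * int * int) :=
  flatten [seq (let r := outcome x y z st.2 in let k := key_of r in
                [seq (k, i.1, i.2) | i <- expand (size r.2) (st.1 + e0)%R c0])
          | st <- states cs].

(** Loops closed within the tangle must have weight 0, for then their value is $-A^2-A^{-2}$ without
    any variable $K_i$, and can be expanded in powers of $A$. *)
Definition tame (x y z : gcode) (cs : seq crossing) : bool :=
  all (fun st => let r := outcome x y z st.2 in
         all (pred1 0) r.2 && all (fun u => u.1 \in boundary) (key_of r)) (states cs).

(* The tangle with strands [x], [y], [z] is worth [c0 * A ^ e0] times the
  tangle with strands [x'], [y'], [z']. *)
Definition tangle_check x y z cs x' y' z' cs' e0 c0 : bool :=
  [&& tame x y z cs, tame x' y' z' cs' &
   same_sum (tangle_terms x y z cs 0%R 1%R) (tangle_terms x' y' z' cs' e0 c0)].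

(** The permutations are the orders in which the three strands can be met along the diagram; the
    premise is the condition that the triangle bounds a region. *)
Definition strand_case (t m l a b c : bool) : bool :=
  ((((t == m) == a) == ((t == l) == b)) && (((t == l) == b) == ((m == l) == c))) ==>
  let ca := (0, a) in let cb := (1, b) in let cc := (2, c) in
  all (fun s : seq gcode =>
    if s is [:: x; y; z] then
      tangle_check x y z [:: ca; cb; cc] (rev x) (rev y) (rev z) [:: ca; cb; cc] 0%R 1%R
    else false)
   (permutations [:: strand t (ca, true) (cb, true);
                     strand m (ca, false) (cc, true);
                     strand l (cb, false) (cc, false)]).

Lemma strand_caseT t m l a b c : strand_case t m l a b c.
Proof. by case: t; case: m; case: l; case: a; case: b; case: c; vm_compute. Qed.

Lemma states_ends cs st : uniq cs -> st \in states cs ->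
  uniq (ends st.2) /\
  forall e, (e \in ends st.2) = (if e.1 is Some x then x.1 \in cs else false).
Proof.
elim: cs st => [|c cs IH] st /=.
  by move=> _; rewrite inE => /eqP-> /=; split=> // e; case: e.1.
case/andP=> cn U.
have h b st' : st' \in states cs ->
    uniq (ends (crossing_arcs c b ++ st'.2)) /\
    forall e, (e \in ends (crossing_arcs c b ++ st'.2)) =
       (if e.1 is Some x then x.1 \in c :: cs else false).
  move=> /(IH _ U)[U' E]; split.
    rewrite ends_cat cat_uniq uniq_crossing U' andbT /=.
    apply/hasPn => e; rewrite E mem_ends_crossing.
    by case: e.1 => //= x xs; apply: contraNneq cn => <-.
  move=> e; rewrite ends_cat mem_cat E mem_ends_crossing.
  by case: e.1 => // x; rewrite inE.
by rewrite mem_cat => /orP[]/mapP[st' s' ->]; apply: h.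
Qed.

Section Moves.
Variables (K : fieldType) (R : comAlgType K) (A : K) (kap lng : nat -> R).

Local Notation value := (value kap lng).
Local Notation state_sum := (state_sum A kap lng).

Hypotheses (A0 : A != 0%R) (kap0 : kap 0 = ((- A ^+ 2 - A ^- 2) *: 1)%R).

Lemma states_cat cs1 cs2 (G : seq (pend * pend * int) -> R) :
  (\sum_(st <- states (cs1 ++ cs2)) A ^ st.1 *: G st.2 =
   \sum_(s <- states cs1) A ^ s.1 *: (\sum_(t <- states cs2) A ^ t.1 *: G (s.2 ++ t.2)))%R.
Proof.
elim: cs1 G => [|c cs1 IH] G /=; first by rewrite big_seq1 /= expr0z scale1r.
rewrite !big_cat !big_map /=.
have e (n : int) b : (\sum_(j <- states (cs1 ++ cs2)) A ^ (j.1 + n) *: G (crossing_arcs c b ++ j.2)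
   = \sum_(s <- states cs1) A ^ (s.1 + n) *:
       (\sum_(t <- states cs2) A ^ t.1 *: G ((crossing_arcs c b ++ s.2) ++ t.2)))%R.
  have IHb := IH (fun g => G (crossing_arcs c b ++ g)).
  transitivity (A ^ n *: (\sum_(st <- states (cs1 ++ cs2)) A ^ st.1 *: G (crossing_arcs c b ++ st.2)))%R.
    by rewrite scaler_sumr; apply: eq_bigr => j _; rewrite scalerA expfzDr // mulrC.
  rewrite IHb scaler_sumr; apply: eq_bigr => s _; rewrite scalerA mulrC -expfzDr //.
  by congr (_ *: _)%R; apply: eq_bigr => t _; rewrite catA.
by rewrite !e.
Qed.

Lemma expandP k e c :
  (((- A ^+ 2 - A ^- 2) ^+ k * A ^ e) *~ c = \sum_(i <- expand k e c) A ^ i.1 *~ i.2)%R.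
Proof.
elim: k e c => [|k IH] e c /=; first by rewrite big_seq1 expr0 mul1r.
rewrite big_cat /= -!IH -mulrzDl -mulrDr exprSr -mulrA mulrNz -mulNrz.
congr (_ *~ _)%R; move: (_ ^+ k)%R => D.
have -> : (A ^ (e - 2) = A ^ e * A ^- 2)%R by rewrite expfzDr.
have -> : (A ^ (e + 2) = A ^ e * A ^+ 2)%R by rewrite expfzDr.
ring.
Qed.

(** What remains once the tangle is smoothed. The inside enters only through the key [k], so an
    identity between formal sums of keys can be glued to any outside. *)
Definition plug (O : seq (pend * pend * int)) (k : seq (pend * int)) (e : pend) :=
  if e \in boundary then nth (e, 0%R) k (index e boundary) else lookup O e.

Lemma value_local I O g h :
  uniq (ends (I ++ O)) -> uniq (ends g) -> {subset ends g <= ends I} ->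
  {subset boundary <= ends I} -> (None, true) \notin ends I ->
  (forall e, e \in ends h -> (e \in boundary) || (e \notin ends I)) ->
  all (fun u => u.1 \in boundary) (key_of (run (lookup I) g)) ->
  (value (lookup (I ++ O)) (g ++ h) =
   (\prod_(l <- (run (lookup I) g).2) kap l) *
   value (plug O (key_of (run (lookup I) g))) h)%R.
Proof.
move=> U Ug gI BI tI hB kB.
have wg : wired (lookup (I ++ O)) g.
  split=> //; first exact: lookup_matching.
  by move=> x /gI xI; apply: lookup_moved => //; rewrite ends_cat mem_cat xI.
have agree x : x \in ends I -> lookup (I ++ O) x = lookup I x.
  by move=> xI; rewrite lookup_cat xI.
have closed x : x \in ends I -> (lookup (I ++ O) x).1 \in ends I.
  by move=> xI; rewrite agree // lookup_closed.
have [e1 e2 _] := run_agree agree closed gI.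
have e3 := run_outside wg closed gI.
have rB e : e \in boundary -> ((run (lookup I) g).1 e).1 \in boundary.
  by move=> eB; apply: (allP kB); apply: map_f.
rewrite value_cat e1; congr (_ * _)%R.
have val e : (e \in boundary) || (e \notin ends I) ->
    (run (lookup (I ++ O)) g).1 e = plug O (key_of (run (lookup I) g)) e.
  rewrite /plug; case: (boolP (e \in boundary)) => [eB _|nB /= nI].
    by rewrite e2 ?BI // (nth_map e) ?index_mem // nth_index.
  by rewrite e3 // lookup_cat (negbTE nI).
apply: (@value_agree _ _ _ _ (fun e => (e \in boundary) || (e \notin ends I))) => //.
  move=> x xQ; rewrite val // /plug unfold_in; case: (boolP (x \in boundary)) => xB.
    rewrite (nth_map x) ?index_mem // nth_index //.
    by rewrite rB.
  move: xQ; rewrite unfold_in (negbTE xB) /= => nI; apply/orP; right.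
  case: (boolP (x \in ends O)) => [/lookup_closed xO|n]; last by rewrite lookup_notin.
  move: U; rewrite ends_cat cat_uniq => /and3P[_ /hasPn d _].
  exact: d.
Qed.

Lemma tangle_sum x y z cs O h (e0 c0 : int) :
  let I := inner_arcs x y z in
  tame x y z cs -> uniq (ends (I ++ O)) -> uniq cs ->
  (forall c l, c \in cs -> (c, l) \in x ++ y ++ z) ->
  (forall e, e \in ends h -> (e \in boundary) || (e \notin ends I)) ->
  (((A ^ e0) *~ c0) *:
     (\sum_(s <- states cs) A ^ s.1 *: value (lookup (I ++ O)) (s.2 ++ h)) =
   \sum_(i <- tangle_terms x y z cs e0 c0) (A ^ i.1.2 *: value (plug O i.1.1) h) *~ i.2)%R.
Proof.
move=> I /allP tm U Uc csin hB.
rewrite big_flatten big_map scaler_sumr; apply: eq_big_seq => s ss.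
have [/allP l0 kB] := andP (tm _ ss).
have [Us Es] := states_ends Uc ss.
have mem e := mem_ends_inner x y z e.
rewrite (value_local U Us) //; first last.
- by rewrite mem.
- by move=> e eB; rewrite mem eB.
- move=> e; rewrite Es mem; case: e.1 => // -[c l] /= cc; by rewrite csin ?orbT.
rewrite -/I -/(outcome x y z s.2) -/I.
set r := outcome x y z s.2.
have -> : (\prod_(l <- r.2) kap l = (- A ^+ 2 - A ^- 2) ^+ size r.2 *: 1)%R.
  rewrite (eq_big_seq (fun=> kap 0)); last by move=> l /l0 /eqP->.
  by rewrite big_const_seq count_predT iter_mulr_1 kap0 exprZn expr1n.
rewrite big_map /=.
rewrite -scalerAl mul1r scalerA mulrzAl -expfzDr // scalerA mulrzAl mulrC.
rewrite [(e0 + _)%R]addrC expandP scaler_suml; apply: eq_bigr => i _.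
by rewrite scalerMzl.
Qed.

End Moves.

(** * Diagrams cut open around a tangle *)

Definition pads : seq passage := map pad (iota 0 6).

Section Tangle.
Variables (w0 w1 w2 w3 : gcode).
Definition outer_arcs :=
  seg None w0 (Some (pad 0)) ++ seg (Some (pad 1)) w1 (Some (pad 2)) ++
  seg (Some (pad 3)) w2 (Some (pad 4)) ++ seg (Some (pad 5)) w3 None.

Definition plain (x y z : gcode) := w0 ++ x ++ w1 ++ y ++ w2 ++ z ++ w3.

Definition padded (x y z : gcode) :=
  w0 ++ pad 0 :: x ++ pad 1 :: w1 ++ pad 2 :: y ++ pad 3 :: w2 ++ pad 4 :: z ++ pad 5 :: w3.

Lemma padded_arcs x y z :
  perm_eq (strand_arcs (padded x y z)) (inner_arcs x y z ++ outer_arcs).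
Proof.
rewrite /strand_arcs /padded !seg_cat /inner_arcs /outer_arcs.
by apply/permP => a; rewrite !count_cat; lia.
Qed.

Definition placed (x y z : gcode) (ci co : seq crossing) : Prop :=
  [/\ uniq (plain x y z), ~~ has (mem pads) (plain x y z), uniq (ci ++ co),
      forall c l, c \in ci -> (c, l) \in x ++ y ++ z
    & forall c l, c \in co -> (c, l) \in w0 ++ w1 ++ w2 ++ w3].

Lemma perm_padded x y z : perm_eq (padded x y z) (pads ++ plain x y z).
Proof.
apply/permP => a; rewrite /padded /plain /pads /=.
by do ?[rewrite count_cat /=]; lia.
Qed.

Lemma padded_uniq x y z ci co : placed x y z ci co -> uniq (padded x y z).
Proof.
case=> U np _ _ _; rewrite (perm_uniq (perm_padded x y z)) cat_uniq U np.
by [].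
Qed.

Lemma filter_padded x y z ci co : placed x y z ci co ->
  [seq p <- padded x y z | p \notin pads] = plain x y z.
Proof.
case=> _ np _ _ _.
have keep s : {subset s <= plain x y z} -> [seq p <- s | p \notin pads] = s.
  move=> sub; apply/all_filterP/allP => p /sub ps; apply: contra np => pp.
  by apply/hasP; exists p.
rewrite -[RHS]keep // /padded /plain.
by do ?[rewrite filter_cat /=].
Qed.

Lemma sub_plain x y z p : p \in plain x y z =
  (p \in x ++ y ++ z) || (p \in w0 ++ w1 ++ w2 ++ w3).
Proof.
rewrite /plain !mem_cat.
by do ?[case: (p \in _); rewrite ?orbT ?orbF //=].
Qed.

Lemma perm_plain x y z :
  perm_eq (plain x y z) ((x ++ y ++ z) ++ (w0 ++ w1 ++ w2 ++ w3)).
Proof. by apply/permP => a; rewrite /plain !count_cat; lia. Qed.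

Lemma outer_inner x y z p : uniq (plain x y z) ->
  p \in w0 ++ w1 ++ w2 ++ w3 -> p \notin x ++ y ++ z.
Proof.
by rewrite (perm_uniq (perm_plain x y z)) cat_uniq => /and3P[_ /hasPn h _] /h.
Qed.

Variables (K : fieldType) (R : comAlgType K) (A : K) (kap lng : nat -> R).
Local Notation value := (value kap lng).
Local Notation state_sum := (state_sum A kap lng).
Hypotheses (A0 : A != 0%R) (kap0 : kap 0 = ((- A ^+ 2 - A ^- 2) *: 1)%R).

Lemma state_sum_tangle x y z ci co : placed x y z ci co ->
  (state_sum (plain x y z) (ci ++ co) =
   \sum_(t <- states co) A ^ t.1 *: (\sum_(s <- states ci) A ^ s.1 *:
     value (lookup (inner_arcs x y z ++ outer_arcs)) (s.2 ++ (map pad_arc pads ++ t.2))))%R.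
Proof.
move=> pl; have [U np Uc ciin coin] := pl.
have UP := padded_uniq pl.
rewrite /state_sum (states_cat A0).
under [RHS]eq_bigr => t _ do rewrite scaler_sumr.
rewrite exchange_big /=; apply: eq_big_seq => s ss.
rewrite scaler_sumr; apply: eq_big_seq => t tt.
rewrite !scalerA [(A ^ t.1 * _)%R]mulrC; congr (_ *: _)%R.
move: Uc; rewrite cat_uniq => /and3P[Ui dis Uo].
have [Us Es] := states_ends Ui ss; have [Ut Et] := states_ends Uo tt.
have Upad : uniq (ends (map pad_arc pads)) by [].
have Epad e : e \in ends (map pad_arc pads) ->
    if e.1 is Some p then p \in pads else false by rewrite mem_ends_pads.
have st_plain e : e \in ends (s.2 ++ t.2) -> if e.1 is Some p then p \in plain x y z else false.
  rewrite ends_cat mem_cat Es Et; case: e.1 => // -[c l] /= h.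
  by rewrite sub_plain; case/orP: h => [/(ciin _ l)->|/(coin _ l)->]; rewrite ?orbT.
rewrite -(filter_padded pl) -value_pads //; first last.
- move=> e /st_plain; case: e.1 => // p pp; apply: contra np => pp'.
  by apply/hasP; exists p.
- by move=> p pp; rewrite (perm_mem (perm_padded x y z)) mem_cat pp.
rewrite (value_ext _ _ _ (lookup_perm (uniq_ends_strand UP) (padded_arcs x y z))).
have UL : uniq (ends (inner_arcs x y z ++ outer_arcs)).
  by rewrite -(perm_uniq (perm_ends (padded_arcs x y z))) uniq_ends_strand.
(* [value_pads] inserts the dummies by splices that come first; commutation moves the smoothings of
   the tangle ahead of them, while the tangle is still isolated. *)
apply: value_perm; last by rewrite perm_catCA.
split; [|exact: lookup_matching|].
  rewrite ends_cat cat_uniq Upad ends_cat cat_uniq Us Ut andbT /=; apply/andP; split.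
    apply/hasPn => e; rewrite -ends_cat => /st_plain h; apply/negP => /Epad.
    by case: e.1 h => // p pp pp'; case/negP: np; apply/hasP; exists p.
  apply/hasPn => e; rewrite Et /= Es; case: e.1 => // p pp; apply/negP => pp'.
  by case/negP: dis; apply/hasP; exists p.1.
move=> e he; apply: lookup_moved => //.
rewrite -(perm_mem (perm_ends (padded_arcs x y z))) mem_ends_strand.
move: he; rewrite ends_cat mem_cat => /orP[/Epad|/st_plain];
  by case: e.1 => // p pp; rewrite (perm_mem (perm_padded x y z)) mem_cat pp ?orbT.
Qed.

Lemma tangle_move x y z ci x' y' z' ci' co (e0 c0 : int) :
  placed x y z ci co -> placed x' y' z' ci' co ->
  tangle_check x y z ci x' y' z' ci' e0 c0 ->
  state_sum (plain x y z) (ci ++ co) =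
  (((A ^ e0) *~ c0) *: state_sum (plain x' y' z') (ci' ++ co))%R.
Proof.
move=> pl pl' /and3P[tm tm' same].
rewrite !state_sum_tangle // scaler_sumr; apply: eq_big_seq => t tt.
rewrite scalerA mulrC -scalerA; congr (_ *: _)%R.
(* For a fixed state of the outside, each side of the move is the image of its formal sum under the
   map that evaluates a key glued to that outside. *)
have sumE u v w cs e c : placed u v w cs co -> tame u v w cs ->
  (((A ^ e) *~ c) *: (\sum_(s <- states cs) A ^ s.1 *:
     value (lookup (inner_arcs u v w ++ outer_arcs)) (s.2 ++ (map pad_arc pads ++ t.2))) =
   \sum_(i <- tangle_terms u v w cs e c) (A ^ i.1.2 *:
     value (plug outer_arcs i.1.1) (map pad_arc pads ++ t.2)) *~ i.2)%R.
  move=> p tam; have [U np Uc ciin coin] := p.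
  have UP := padded_uniq p.
  have UL : uniq (ends (inner_arcs u v w ++ outer_arcs)).
    by rewrite -(perm_uniq (perm_ends (padded_arcs u v w))) uniq_ends_strand.
  apply: tangle_sum => //.
    by move: Uc; rewrite cat_uniq => /and3P[].
  move: Uc; rewrite cat_uniq => /and3P[_ _ Uo]; have [_ Et] := states_ends Uo tt.
  move=> a; rewrite ends_cat mem_cat Et mem_ends_pads mem_ends_inner.
  case: (a \in boundary) => //=; case: a.1 => // -[d l]; case/orP => h.
    by apply: contra np => h'; apply/hasP; exists (d, l); rewrite ?sub_plain ?h'.
  by have := outer_inner U (coin d l h).
rewrite (sumE x' y' z' ci' e0 c0 pl' tm') -[LHS]scale1r.
have -> : (1 = (A ^ (0 : int)) *~ 1 :> K)%R by rewrite expr0z.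
rewrite (sumE x y z ci 0%R 1%R pl tm).
exact: (same_sumP (fun i => A ^ i.2 *: value (plug outer_arcs i.1) (map pad_arc pads ++ t.2))%R same).
Qed.

End Tangle.

Definition tangle_names (t : gcode) (ci : seq crossing) : Prop :=
  uniq ci /\ forall c l, ((c, l) \in t) = (c \in ci).

(** The computed checks concern fixed names, so the whole diagram is first renamed by [f], which
    must keep signs and stay clear of the names 3 to 8 of the dummies. *)
Lemma arrow_tangle_move w0 w1 w2 w3 x y z ci x' y' z' ci' f (e0 c0 : int) :
  gauss (plain w0 w1 w2 w3 x y z) -> gauss (plain w0 w1 w2 w3 x' y' z') ->
  tangle_names (x ++ y ++ z) ci -> tangle_names (x' ++ y' ++ z') ci' ->
  injective f -> (forall c, (f c).2 = c.2) ->
  (forall c, (f c).1 \notin iota 3 6) ->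
  tangle_check (map (rename f) x) (map (rename f) y) (map (rename f) z) (map f ci)
    (map (rename f) x') (map (rename f) y') (map (rename f) z') (map f ci') e0 c0 ->
  arrow_polynomial (plain w0 w1 w2 w3 x y z) =
  (((varA ^ e0) *~ c0) *: arrow_polynomial (plain w0 w1 w2 w3 x' y' z'))%R.
Proof.
move=> g g' nm nm' f_inj f_sign f_pad chk.
set out := w0 ++ w1 ++ w2 ++ w3.
pose co := undup (map fst out).
have coE c : (c \in co) = (c \in map fst out) by rewrite mem_undup.
have setup u v w cs : gauss (plain w0 w1 w2 w3 u v w) -> tangle_names (u ++ v ++ w) cs ->
    [/\ uniq (cs ++ co), cs ++ co =i crossings (plain w0 w1 w2 w3 u v w) &
        forall c l, c \in co -> (c, l) \in out].
  move=> gw [Uc cE]; have [Uw _] := andP gw.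
  have coout c l : c \in co -> (c, l) \in out.
    rewrite coE => /mapP[[c' l'] pout /= ->].
    have pp : (c', l) \in plain w0 w1 w2 w3 u v w.
      have pw : (c', l') \in plain w0 w1 w2 w3 u v w by rewrite sub_plain pout orbT.
      case: (eqVneq l l') => [-> //|ne]; rewrite -(mate_in gw).
      by rewrite /mate /=; case: l ne; case: l' pw {pout}.
    move: pp; rewrite sub_plain; case/orP => // pin.
    have := outer_inner Uw pout; rewrite cE.
    by rewrite cE in pin; rewrite pin.
  split=> //.
    rewrite cat_uniq Uc undup_uniq andbT /=; apply/hasPn => c /(coout _ true) h.
    by rewrite -(cE _ true); apply: outer_inner Uw h.
  move=> c; rewrite mem_cat coE; apply/idP/imfsetP => /=.
    case/orP => [cc|/mapP[p pout ->]].
      by exists (c, true) => //; rewrite sub_plain cE cc.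
    by exists p => //; rewrite sub_plain pout orbT.
  case=> -[c' l] /=; rewrite sub_plain => /orP[h|pout] ->.
    by rewrite cE in h; rewrite h.
  by rewrite (map_f fst pout) orbT.
have place u v w cs : gauss (plain w0 w1 w2 w3 u v w) -> tangle_names (u ++ v ++ w) cs ->
  let r := map (rename f) in
  placed (r w0) (r w1) (r w2) (r w3) (r u) (r v) (r w) (map f cs) (map f co).
  move=> gw nw r; have [h1 h2 h3] := setup _ _ _ _ gw nw.
  have rE : plain (r w0) (r w1) (r w2) (r w3) (r u) (r v) (r w) = r (plain w0 w1 w2 w3 u v w).
    by rewrite /plain /r !map_cat.
  split.
  - by rewrite rE map_inj_uniq; [case/andP: gw|exact: rename_inj].
  - rewrite rE; apply/hasPn => p /mapP[p' _ ->]; apply/negP => /mapP[i].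
    rewrite mem_iota => ii [e _]; have := f_pad p'.1; rewrite mem_iota e /=.
    by move: ii; lia.
  - by rewrite -map_cat map_inj_uniq.
  - move=> c l /mapP[d dc ->]; rewrite /r -!map_cat -[(f d, l)]/(rename f (d, l)).
    by rewrite (mem_map (rename_inj f_inj)) (proj2 nw).
  - move=> c l /mapP[d dc ->]; rewrite /r -!map_cat -[(f d, l)]/(rename f (d, l)).
    by rewrite (mem_map (rename_inj f_inj)) h3.
have [u1 s1 _] := setup _ _ _ _ g nm; have [u2 s2 _] := setup _ _ _ _ g' nm'.
rewrite (arrow_state_sum g u1 s1) (arrow_state_sum g' u2 s2).
have ren u v w cs := state_sum_rename varA loop_value (fun n => Lvar n./2) f_inj f_sign
  (plain w0 w1 w2 w3 u v w) (cs ++ co).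
rewrite -(ren x y z) -(ren x' y' z') /plain !map_cat -!/(plain _ _ _ _ _ _ _).
have kap0 : loop_value 0 = ((- varA ^+ 2 - varA ^- 2) *: 1)%R by [].
exact: (tangle_move (fun n => Lvar n./2) varA_neq0 kap0 (place _ _ _ _ g nm) (place _ _ _ _ g' nm') chk).
Qed.

Definition similar (p q : arrow_ring) : Prop := exists2 u : laurent, u != 0%R & p = (u *: q)%R.

Lemma similar_sym p q : similar p q -> similar q p.
Proof.
case=> u u0 ->; exists (u^-1)%R; first by rewrite invr_eq0.
by rewrite scalerA mulVf // scale1r.
Qed.

Lemma unit_neq0 (e : int) (b : bool) : ((varA ^ e) *~ (if b then -1 else 1) != 0)%R.
Proof.
have h : (varA ^ e != 0)%R by rewrite expfz_neq0 // varA_neq0.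
by case: b; rewrite ?mulrN1z ?oppr_eq0.
Qed.

(** The shift by 9 frees the names 0 to 2 for the tangle and 3 to 8 for the dummies. Repeating an
    argument serves tangles with fewer crossings. *)
Definition number3 (a b d c : crossing) : crossing :=
  if c == a then (0, c.2) else if c == b then (1, c.2)
  else if c == d then (2, c.2) else (c.1 + 9, c.2).

Lemma number3_inj a b d : injective (number3 a b d).
Proof.
move=> c c'; rewrite /number3.
case: (eqVneq c a) => [->|_]; last case: (eqVneq c b) => [->|_];
  last case: (eqVneq c d) => [->|_];
  (case: (eqVneq c' a) => [->|_]; last case: (eqVneq c' b) => [->|_];
  last case: (eqVneq c' d) => [->|_]) => //; case; try lia.
by move=> e1 e2; rewrite [c]surjective_pairing [c']surjective_pairing e2; congr (_, _); lia.
Qed.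

Lemma number3_sign a b d c : (number3 a b d c).2 = c.2.
Proof. by rewrite /number3; do 3?case: eqP. Qed.

Lemma number3_pad a b d c : (number3 a b d c).1 \notin iota 3 6.
Proof. by rewrite /number3 mem_iota; do 3?[case: eqP => //= _]; lia. Qed.

(** The factor is $-A^3$ or $-A^{-3}$, according to the sign of the kink. *)
Lemma kink_check o s :
  let x := [:: ((0, s), o); ((0, s), ~~ o)] in
  tangle_check x [::] [::] [:: (0, s)] [::] [::] [::] [::]
    (if s then 3%R else (-3)%R) (-1)%R.
Proof. by case: o; case: s; vm_compute. Qed.

Lemma bigon_check o dir s :
  let x := [:: ((0, s), o); ((1, ~~ s), o)] in
  let y := strand dir ((0, s), ~~ o) ((1, ~~ s), ~~ o) in
  tangle_check x y [::] [:: (0, s); (1, ~~ s)] [::] [::] [::] [::] 0%R 1%R.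
Proof. by case: o; case: dir; case: s; vm_compute. Qed.

Lemma arrow_omega (w w' : gcode) : gauss w -> gauss w' -> omega w w' ->
  similar (arrow_polynomial w') (arrow_polynomial w).
Proof.
move=> g g' om; case: om g g' => {w w'}.
- move=> w1 w2 c o g g'.
  (* The kink occupies one strand of the tangle; the other two strands are empty. *)
  have e t : w1 ++ t ++ w2 = plain w1 w2 [::] [::] t [::] [::] by rewrite /plain /= !cats0.
  rewrite (e [:: _; _]) in g' *; rewrite -[w1 ++ w2]/(w1 ++ [::] ++ w2) e in g *.
  exists (varA ^ (if c.2 then 3%R else (-3)%R) *~ (-1))%R; first exact: (unit_neq0 _ true).
  apply: (arrow_tangle_move (ci := [:: c]) (ci' := [::]) (f := number3 c c c)) => //.
  + split=> // d l; rewrite /= !inE !xpair_eqE; case: (d == c) => //=.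
    by case: o {g g'}; case: l.
  + exact: number3_inj.
  + exact: number3_sign.
  + exact: number3_pad.
  by rewrite /= /rename /number3 /= eqxx; apply: kink_check.
- move=> w1 w2 w3 c d o dir cd g g'.
  have e t u : w1 ++ t ++ w2 ++ u ++ w3 = plain w1 w2 w3 [::] t u [::].
    by rewrite /plain /= cats0.
  rewrite e in g' *; rewrite -[w1 ++ w2 ++ w3]/(w1 ++ [::] ++ w2 ++ [::] ++ w3) e in g *.
  have ncd : d != c by apply: contraNneq cd => ->.
  have sd : d.2 = ~~ c.2 by move: cd; case: (c.2); case: (d.2).
  exists (varA ^ 0%R *~ 1)%R; first exact: (unit_neq0 _ false).
  apply: (arrow_tangle_move (ci := [:: c; d]) (ci' := [::]) (f := number3 c d d)) => //.
  + split=> [|c' l]; first by rewrite /= inE eq_sym ncd.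
    rewrite cats0 mem_cat; case: (dir); rewrite !inE !xpair_eqE;
      by case: (c' == c); case: (c' == d); case: (o); case: l.
  + exact: number3_inj.
  + exact: number3_sign.
  + exact: number3_pad.
  have := bigon_check o dir c.2; rewrite -sd.
  by case: (dir); rewrite /= /rename /number3 /= !eqxx (negbTE ncd).
- move=> w0 w1 w2 w3 x y z a b c t m l p s1 s2 g g'.
  rewrite -/(plain w0 w1 w2 w3 x y z) in g *.
  rewrite -/(plain w0 w1 w2 w3 (rev x) (rev y) (rev z)) in g' *.
  apply: similar_sym; exists (varA ^ 0%R *~ 1)%R; first exact: (unit_neq0 _ false).
  have pf : perm_eq (x ++ y ++ z) (strand t (a, true) (b, true) ++
      strand m (a, false) (c, true) ++ strand l (b, false) (c, false)).
    by have := perm_flatten p; rewrite /= !cats0.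
  have U : uniq (x ++ y ++ z).
    have [U _] := andP g; move: U.
    by rewrite (perm_uniq (perm_plain w0 w1 w2 w3 x y z)) cat_uniq => /and3P[].
  rewrite (perm_uniq pf) in U.
  (* The three crossings differ, since otherwise a passage would occur twice in the code. *)
  have nab : b != a.
    by apply: contraTneq U => ->; case: (t); rewrite /= inE eqxx.
  have nac : c != a.
    apply: contraTneq U => ->; case: (t); case: (m);
      by rewrite /= ?(inE, mem_cat) ?eqxx ?orbT ?andbF.
  have nbc : c != b.
    apply: contraTneq U => ->; case: (l); rewrite !cat_uniq /= !inE eqxx ?andbF //.
  have nm u : perm_eq u (x ++ y ++ z) -> tangle_names u [:: a; b; c].
    move=> pu; split=> [|d l']; first by rewrite /= !inE !negb_or ![a == _]eq_sym [b == c]eq_sym nab nac nbc.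
    rewrite (perm_mem pu) (perm_mem pf) !mem_cat.
    case: (t); case: (m); case: (l); rewrite !inE !xpair_eqE;
      by case: (d == a); case: (d == b); case: (d == c); case: l'.
  apply: (arrow_tangle_move (ci := [:: a; b; c]) (ci' := [:: a; b; c]) (f := number3 a b c)) => //.
  + exact: nm.
  + by apply: nm; do ?apply: perm_cat; rewrite perm_rev.
  + exact: number3_inj.
  + exact: number3_sign.
  + exact: number3_pad.
  have := strand_caseT t m l a.2 b.2 c.2.
  rewrite /strand_case s1 s2 !eqxx /= => /allP h.
  have := h [:: map (rename (number3 a b c)) x; map (rename (number3 a b c)) y;
                map (rename (number3 a b c)) z].
  rewrite !map_rev /number3 !eqxx (negbTE nab) (negbTE nac) (negbTE nbc); apply.
  rewrite mem_permutations.
  have ms dir u v : map (rename (number3 a b c)) (strand dir u v) =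
      strand dir (rename (number3 a b c) u) (rename (number3 a b c) v) by case: dir.
  have := perm_map (map (rename (number3 a b c))) p.
  by rewrite [map _ [:: strand _ _ _; _; _]]/= !ms /rename /number3 /= !eqxx
    (negbTE nab) (negbTE nac) (negbTE nbc).
Qed.

(** * Invariance of the degree *)

Lemma arrow_isotopic (w w' : gcode) : gauss w -> gauss w' -> isotopic w w' ->
  arrow_polynomial w' = arrow_polynomial w.
Proof.
move=> g g' [f [f_inj f_sign ew]].
have names (u : gcode) : undup (map fst u) =i crossings u.
  move=> c; rewrite mem_undup; apply/mapP/imfsetP => /= -[p pu ->]; by exists p.
have fw : map f (undup (map fst w)) =i crossings w'.
  move=> c; rewrite -names mem_undup ew -map_comp; apply/mapP/mapP.
    by case=> d; rewrite mem_undup => /mapP[p pw ->] ->; exists p.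
  by case=> p pw ->; exists p.1 => //; rewrite mem_undup map_f.
rewrite (arrow_state_sum g (undup_uniq _) (names w)).
have U' : uniq (map f (undup (map fst w))) by rewrite map_inj_uniq ?undup_uniq.
rewrite (arrow_state_sum g' U' fw) ew.
exact: (state_sum_rename varA loop_value (fun n => Lvar n./2) f_inj f_sign).
Qed.

(** The coefficients form a field, so a nonzero scalar leaves the set of monomials unchanged. *)
Lemma Lambda_degree_similar p q : similar p q -> Lambda_degree p = Lambda_degree q.
Proof. by case=> u u0 ->; rewrite /Lambda_degree msuppZ (negbTE u0). Qed.

Lemma Lambda_degree_equivalent (D D' : diagram) : equivalent D D' ->
  Lambda_degree (arrow_polynomial D) = Lambda_degree (arrow_polynomial D').
Proof.
elim=> {D D'}.
- move=> D D' [iso|om].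
    by rewrite (arrow_isotopic (code_gauss D) (code_gauss D') iso).
  symmetry; apply: Lambda_degree_similar.
  exact: (arrow_omega (code_gauss D) (code_gauss D') om).
- by [].
- by move=> D D' _ e; exact: esym e.
- move=> D D' D'' _ e1 _ e2; exact (eq_trans e1 e2).
Qed.

Definition Lambda_bounded (k : nat) (p : arrow_ring) : Prop :=
  forall m, m \in msupp p -> monom_Lambda_degree m <= k.

Lemma Lambda_bounded_degree k p : Lambda_bounded k p -> Lambda_degree p <= k.
Proof. by move=> h; apply/bigmax_leqP_seq => m mp _; apply: h. Qed.

Lemma Lambda_bounded0 k : Lambda_bounded k 0%R.
Proof. by move=> m; rewrite msupp0 inE. Qed.

Lemma Lambda_bounded1 k : Lambda_bounded k 1%R.
Proof.
move=> m /(fsubsetP (msuppC_le _)); rewrite inE => /eqP->.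
by rewrite /monom_Lambda_degree mdom1 big_seq_fset0.
Qed.

Lemma Lambda_boundedD k p q : Lambda_bounded k p -> Lambda_bounded k q ->
  Lambda_bounded k (p + q)%R.
Proof.
by move=> hp hq m /(fsubsetP (msuppD_le _ _)); rewrite inE => /orP[/hp|/hq].
Qed.

Lemma Lambda_boundedZ k (u : laurent) p : Lambda_bounded k p -> Lambda_bounded k (u *: p)%R.
Proof. by move=> hp m /(fsubsetP (msuppZ_le _ _))/hp. Qed.

Lemma Lambda_boundedM k p q : Lambda_bounded k p -> Lambda_bounded k q ->
  Lambda_bounded k (p * q)%R.
Proof.
move=> hp hq m /msuppM_le[m1 [m2 [/hp/bigmax_leqP_seq h1 /hq/bigmax_leqP_seq h2 ->]]].
by apply/bigmax_leqP_seq => v; rewrite mdomD inE => /orP[/h1|/h2] h _; apply: h.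
Qed.

Lemma Lambda_bounded_var k v : (if v is inr i then i else 0) <= k ->
  Lambda_bounded k (var v).
Proof.
move=> vk m; rewrite /var => /(fsubsetP msuppU_le); rewrite inE => /eqP->.
by rewrite /monom_Lambda_degree mdomU big_seq_fset1.
Qed.

(** Only an upper bound is sought, so cancellations between states can do no harm and each state may
    be bounded separately. *)
Lemma arrow_Lambda_bounded (w : gcode) k :
  (forall S, half_surviving (long_cusps w S) <= k) ->
  Lambda_degree (arrow_polynomial w) <= k.
Proof.
move=> h; apply: Lambda_bounded_degree.
apply: (big_ind (Lambda_bounded k)); first exact: Lambda_bounded0.
  by move=> p q; apply: Lambda_boundedD.
move=> S _; apply/Lambda_boundedZ/Lambda_boundedM.
  rewrite /Lvar; case: ifP => _; first exact: Lambda_bounded1.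
  by apply: Lambda_bounded_var.
apply: (big_ind (Lambda_bounded k)); first exact: Lambda_bounded1.
  by move=> p q; apply: Lambda_boundedM.
move=> d _; rewrite /Kvar; case: ifP => _; first exact: Lambda_bounded1.
by apply: Lambda_bounded_var.
Qed.

(** * Numberings of spherical diagrams *)

Section Coboundary.
Variable D : finType.
Implicit Types (g : D -> D) (u : D -> rat).

Definition fun_row u : 'rV[rat]_#|D| := (\row_j u (enum_val j))%R.
Definition row_fun (v : 'rV[rat]_#|D|) (x : D) : rat := (v 0 (enum_rank x))%R.

(* Right multiplication by [cobound g] sends [u] to [u \o g - u]. *)
Definition cobound g : 'M[rat]_#|D| :=
  (\matrix_(i, j) (i == enum_rank (g (enum_val j)))%:R - 1%:M)%R.

Lemma row_funK v : fun_row (row_fun v) = v.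
Proof. by apply/rowP => j; rewrite !mxE /row_fun enum_valK. Qed.

Lemma fun_rowK u : row_fun (fun_row u) =1 u.
Proof. by move=> x; rewrite /row_fun mxE enum_rankK. Qed.

Lemma row_fun_cobound v g x :
  (row_fun (v *m cobound g) x = row_fun v (g x) - row_fun v x)%R.
Proof.
rewrite /row_fun mulmxBr mulmx1 !mxE; congr (_ - _)%R.
rewrite (bigD1 (enum_rank (g x))) //= !mxE enum_rankK eqxx mulr1 big1 ?addr0 //.
by move=> i ne; rewrite mxE enum_rankK (negbTE ne) mulr0.
Qed.

Lemma fun_row_cobound u g : (fun_row u *m cobound g = fun_row (fun x => u (g x) - u x))%R.
Proof.
apply/rowP => j; have := row_fun_cobound (fun_row u) g (enum_val j).
by rewrite !fun_rowK /row_fun enum_valK => ->; rewrite !mxE.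
Qed.

(** Consequently the functions orthogonal to the image of [cobound g] are the [g]-invariant ones. *)
Lemma cobound_tr v g x : injective g ->
  (row_fun (v *m (cobound g)^T) (g x) = row_fun v x - row_fun v (g x))%R.
Proof.
move=> gI; rewrite /row_fun /cobound linearB /= trmx1 mulmxBr mulmx1 !mxE; congr (_ - _)%R.
rewrite (bigD1 (enum_rank x)) //= !mxE enum_rankK eqxx mulr1 big1 ?addr0 //.
move=> i ne; rewrite !mxE (inj_eq enum_rank_inj) (inj_eq gI).
case: eqP => [e|]; last by rewrite mulr0.
by rewrite e enum_valK eqxx in ne.
Qed.

(** The rows of [J], the indicator functions of the orbits, are killed by [cobound g]; [Q], the
    evaluation at the roots, shows that they are independent. *)
Lemma rank_cobound g : injective g -> \rank (cobound g) + fcard g D <= #|D|.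
Proof.
move=> gI; pose A := froots g.
pose J := (\matrix_(k < #|A|, j < #|D|) (froot g (enum_val j) == enum_val k)%:R)%R : 'M[rat]_(_, _).
pose Q := (\matrix_(j < #|D|, k < #|A|) (enum_val j == enum_val k)%:R)%R : 'M[rat]_(_, _).
have JQ : (J *m Q = 1%:M)%R.
  apply/matrixP => k k'; rewrite !mxE (bigD1 (enum_rank (enum_val k'))) //=.
  rewrite !mxE enum_rankK eqxx mulr1 big1 ?addr0; last first.
    move=> j ne; rewrite !mxE; case: (eqVneq (enum_val j) (enum_val k')) => [e|_].
      by rewrite -e enum_valK eqxx in ne.
    by rewrite mulr0.
  have := enum_valP k'; rewrite -topredE /= => /eqP ->.
  by rewrite (inj_eq enum_val_inj) eq_sym.
have rJ : #|A| <= \rank J.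
  by have := mxrankM_maxl J Q; rewrite JQ mxrank1.
have JB : (J *m cobound g = 0)%R.
  apply/row_matrixP => k; rewrite row_mul row0 -[RHS]row_funK -[LHS]row_funK.
  apply/rowP => j; rewrite !mxE row_fun_cobound /row_fun !mxE !enum_rankK.
  suff -> : froot g (g (enum_val j)) = froot g (enum_val j) by rewrite subrr.
  by apply/esym/(fingraph.rootP (fconnect_sym gI))/fconnect1.
have : (J <= kermx (cobound g))%MS by apply/sub_kermxP.
move/mxrankS; rewrite mxrank_ker => h.
have -> : fcard g D = #|A|.
  by apply: eq_card => x; rewrite !inE andbT.
have := rank_leq_row (cobound g); lia.
Qed.

Section Sphere.
Variables (s t f : D -> D).
Hypotheses (sI : injective s) (tK : involutive t) (fE : forall x, f x = s (t x))
  (transitive : forall u, (forall x, u (s x) = u x) -> (forall x, u (t x) = u x) ->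
     forall x y, u x = u y)
  (euler : fcard s D + fcard t D + fcard f D = #|D| + 2).

Let fI : injective f.
Proof. by move=> x y; rewrite !fE => /sI /(inv_inj tK). Qed.

Let rank_const (m : nat) (X : 'M[rat]_(m, #|D|)) :
  (forall v, (v <= X)%MS -> forall x y, row_fun v x = row_fun v y) -> \rank X <= 1.
Proof.
move=> h; apply: leq_trans (rank_leq_row (const_mx 1 : 'rV[rat]_#|D|)%R).
apply/mxrankS/rV_subP => v /h hv.
case: (pickP (mem D)) => [d0 _|D0].
  have -> : v = (row_fun v d0 *: const_mx 1)%R.
    apply/rowP => j; rewrite !mxE mulr1 -(enum_valK j).
    by rewrite -[LHS]/(row_fun v (enum_val j)); apply: hv.
  by rewrite scalemx_sub.
have -> : v = 0%R by apply/rowP => j; have := D0 (enum_val j).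
by rewrite sub0mx.
Qed.

(* The functions which are coboundaries for both [s] and [t] form a space that
  contains the image of the [f]-invariant functions under [u |-> u \o t - u]; by
  Euler's formula and connectedness, both have dimension [fcard f D - 1]. *)
Lemma sphere_cobound (phi psi : D -> rat) :
  (forall x, (phi (s x) - phi x = psi (t x) - psi x)%R) ->
  exists h : D -> rat, (forall x, h (f x) = h x) /\
    forall x, (h (t x) - h x = phi (s x) - phi x)%R.
Proof.
move=> hyp.
set S := cobound s; set T := cobound t; set F := cobound f.
have kerE g v : (v <= kermx (cobound g))%MS ->
    forall x, row_fun v (g x) = row_fun v x.
  move/sub_kermxP => h x; apply/eqP; rewrite -subr_eq0 -row_fun_cobound h.
  by rewrite /row_fun mxE.
(* A function orthogonal to both images is invariant under [s] and [t], hence constant; so the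
   images together have codimension at most 1. *)
have rsum : #|D| <= \rank (S + T)%MS + 1.
  set W := (S + T)%MS.
  have : \rank (kermx W^T) <= 1.
    apply: rank_const => v /sub_kermxP vW.
    have inv g : injective g -> (cobound g <= W)%MS ->
        forall x, row_fun v (g x) = row_fun v x.
      move=> gI /submxP[Y eY] x; apply/eqP; rewrite eq_sym -subr_eq0 -cobound_tr //.
      by rewrite eY trmx_mul mulmxA vW mul0mx /row_fun mxE.
    apply: transitive; apply: inv => //.
    - by rewrite addsmxSl.
    - exact: inv_inj tK.
    - by rewrite addsmxSr.
  rewrite mxrank_ker mxrank_tr.
  have := rank_leq_row W; lia.
(* If [z] is invariant under [f], then [z (s x) = z (t x)] because [s x = f (t x)]: its coboundaries
   for [s] and for [t] coincide. *)
have YC : ((kermx F *m T)%R <= S :&: T)%MS.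
  rewrite sub_capmx submxMl andbT; apply/rV_subP => v /submxP[y ->].
  rewrite mulmxA; set z := (y *m kermx F)%R.
  have zF := kerE f z (submxMl _ _).
  suff -> : (z *m T = z *m S)%R by rewrite submxMl.
  rewrite -[LHS]row_funK -[RHS]row_funK; apply/rowP => j; rewrite !mxE !row_fun_cobound.
  have -> : s (enum_val j) = f (t (enum_val j)) by rewrite fE tK.
  by rewrite zF.
have rY : fcard f D <= \rank (kermx F *m T)%R + 1.
  have rc : \rank (kermx F :&: kermx T)%MS <= 1.
    apply: rank_const => v; rewrite sub_capmx => /andP[/kerE vf /kerE vt].
    apply: transitive => // x; have -> : s x = f (t x) by rewrite fE tK.
    by rewrite vf vt.
  have := mxrank_mul_ker (kermx F) T; rewrite mxrank_ker.
  have := rank_cobound fI; rewrite -/F; lia.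
have rS := rank_cobound sI; have rT := rank_cobound (inv_inj tK).
have rC := mxrank_sum_cap S T.
have : (fun_row (fun x => phi (s x) - phi x)%R <= (kermx F *m T)%R)%MS.
  have -> : ((kermx F *m T)%R :=: S :&: T)%MS.
    apply/eqmxP; rewrite YC /=.
    have [_ <-] := mxrank_leqif_sup YC.
    rewrite eqn_leq mxrankS //=.
    (* By Euler's formula [rc <= (n - cs) + (n - ct) - (n - 1) = cf - 1 <= r]. *)
    have count (rs rt rc r w cs ct cf n : nat) : rs + cs <= n -> rt + ct <= n ->
      w + rc = rs + rt -> n <= w + 1 -> cf <= r + 1 -> cs + ct + cf = n + 2 -> rc <= r.
      by move=> *; lia.
    exact: count rS rT rC rsum rY euler.
  rewrite sub_capmx -fun_row_cobound submxMl /=.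
  have -> : (fun_row phi *m S = fun_row psi *m T)%R.
    by rewrite !fun_row_cobound; apply/rowP => j; rewrite !mxE hyp.
  by rewrite submxMl.
case/submxP => y; rewrite mulmxA => e.
exists (row_fun (y *m kermx F)%R); split; first by apply: kerE; rewrite submxMl.
by move=> x; rewrite -row_fun_cobound -e fun_rowK.
Qed.

End Sphere.
End Coboundary.

(** [chi] sums [a] along each orbit, starting at the root; the vanishing of the total makes the step
    back to the root consistent. *)
Lemma orbit_cobound (D : finType) (f : D -> D) (a : D -> rat) : injective f ->
  (forall x, (\sum_(y | fconnect f x y) a y = 0)%R) ->
  exists chi : D -> rat, forall x, (chi (f x) - chi x = a x)%R.
Proof.
move=> fI a0.
pose pre r n := (\sum_(i < n) a (iter i f r))%R.
exists (fun x => pre (froot f x) (findex f (froot f x) x)) => x.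
have -> : froot f (f x) = froot f x.
  by apply/esym/(fingraph.rootP (fconnect_sym fI))/fconnect1.
set r := froot f x.
have rx : fconnect f r x by rewrite fconnect_sym //; apply: connect_root.
have lt := findex_max rx; have ix := iter_findex rx.
have -> : a x = a (iter (findex f r x) f r) by rewrite ix.
have fx : f x = iter (findex f r x).+1 f r by rewrite /= ix.
case: (ltnP (findex f r x).+1 (fingraph.order f r)) => h.
  by rewrite fx findex_iter // /pre big_ord_recr /= ix addrAC subrr add0r.
have e : (findex f r x).+1 = fingraph.order f r by apply/eqP; rewrite eqn_leq lt h.
have fxr : f x = r by rewrite fx e iter_order.
rewrite fxr findex0 /pre big_ord0 sub0r; apply/eqP; rewrite eqr_oppLR -addr_eq0 addrC.
have := a0 r; rewrite (eq_bigl (fun y => y \in orbit f r)); last first.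
  by move=> y; rewrite fconnect_orbit.
rewrite -big_uniq ?orbit_uniq //= /orbit sum_traject -e.
by rewrite big_ord_recr /= addrC => ->.
Qed.

Lemma fcard_involution (D : finType) (t : D -> D) : involutive t ->
  (forall x, t x != x) -> (fcard t D).*2 = #|D|.
Proof.
move=> tK tne; have tI := inv_inj tK.
have ord2 x : fingraph.order t x = 2.
  have <- : #|pred2 x (t x)| = 2 by rewrite card2 eq_sym tne.
  apply: eq_card => y; rewrite !inE; apply/idP/idP.
    move=> /iter_findex <-; elim: (findex _ _ _) => [|n] /=; first by rewrite eqxx.
    by case/orP => /eqP ->; rewrite ?tK eqxx ?orbT.
  by case/orP => /eqP ->; rewrite ?connect0 ?fconnect1.
rewrite -muln2 (@fcard_order_set _ t tI 2) //.
by apply/subsetP => x _; rewrite inE ord2.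
Qed.

(** * The rotation system of a code and its regions *)

Section Planar.
Variable w : gcode.
Hypothesis wg : gauss w.
Notation D := (dart w).
Notation tail := (tail_dart w).
Notation head := (head_dart w).

Lemma site_ccw (d : D) x out : site d = Some (x, out) ->
  site (ccw d) = Some (mate x, if x.2 == x.1.2 then out else ~~ out).
Proof.
by move=> e; have [xw _] := site_inv wg e; rewrite /ccw e site_dart_at // mate_in.
Qed.

Lemma ccw_None (d : D) : site d = None -> ccw d = d.
Proof. by rewrite /ccw => ->. Qed.

Lemma ccw_dart_at x out : x \in w ->
  ccw (dart_at w x out) = dart_at w (mate x) (if x.2 == x.1.2 then out else ~~ out).
Proof. by move=> xw; rewrite /ccw site_dart_at. Qed.

Lemma ccw_inj : injective (@ccw w).
Proof.
move=> d d' e; case s: (site d) => [[x o]|]; case s': (site d') => [[x' o']|].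
- have := site_ccw s; rewrite e (site_ccw s') => -[m1 /negb_inj m2 oo].
  have xx : x' = x by rewrite [x]surjective_pairing [x']surjective_pairing m1 m2.
  rewrite xx in oo s'; have [_ <-] := site_inv wg s; have [_ <-] := site_inv wg s'.
  by congr dart_at; case: eqP oo => // _ /negb_inj.
- by have := site_ccw s; rewrite e ccw_None // s'.
- by have := site_ccw s'; rewrite -e ccw_None // s.
- by rewrite -(ccw_None s) e ccw_None.
Qed.

Lemma face_inj : injective (@face w).
Proof. by move=> d d' /ccw_inj/(inv_inj (@oppK w)). Qed.

Lemma ccw2_dart_at x out : x \in w -> ccw (ccw (dart_at w x out)) = dart_at w x (~~ out).
Proof.
move=> xw; rewrite ccw_dart_at // ccw_dart_at ?mate_in // mateK; congr dart_at.
by case: x {xw} => -[n s] l; rewrite /mate /=; case: l; case: s.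
Qed.

Definition turn : rel D := [rel x y | (y == ccw x) || (y == opp x)].

(** Two quarter turns at a crossing lead to the opposite half-strand, so [opp] and [ccw] suffice to
    follow the strand from the tail. *)
Lemma connect_turn (d : D) : connect turn tail d.
Proof.
have toopp x : connect turn x (opp x) by apply: connect1; rewrite /turn /= eqxx orbT.
have toccw x : connect turn x (ccw x) by apply: connect1; rewrite /turn /= eqxx.
suff h (i : nat) (lt : i < (size w).+1) : connect turn tail (Ordinal lt, false).
  case: d => [[i lt] []]; last exact: h.
  by apply: connect_trans (h i lt) _; apply: (toopp (Ordinal lt, false)).
elim: i lt => [|i IH] lt.
  have -> : (Ordinal lt, false) = tail by congr (_, _); apply: val_inj.
  exact: connect0.
have lt' : i < size w by [].
apply: connect_trans (IH (ltnW lt)) _; apply: connect_trans (toopp _) _.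
have xw := mem_nth (((0, true), true) : passage) lt'; set x := nth _ _ _ in xw.
have ix : index x w = i by rewrite index_uniq //; case/andP: wg.
have -> : opp (Ordinal (ltnW lt), false) = dart_at w x false.
  by rewrite /opp /dart_at /=; congr (_, _); apply: val_inj; rewrite /= ix inordK // ltnW.
have -> : (Ordinal lt, false) = dart_at w x true.
  by rewrite /dart_at /=; congr (_, _); apply: val_inj; rewrite /= ix inordK.
rewrite -[true]/(~~ false) -ccw2_dart_at //.
exact: connect_trans (toccw _) (toccw _).
Qed.

Lemma turn_const (u : D -> rat) : (forall x, u (ccw x) = u x) ->
  (forall x, u (opp x) = u x) -> forall x y, u x = u y.
Proof.
move=> uc uo; suff h x : u x = u tail by move=> x y; rewrite !h.
have /connectP[p pp ->] := connect_turn x.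
elim: p (tail) pp => [|z p IH] y //= /andP[/orP[]/eqP-> pp]; by rewrite IH // ?uc ?uo.
Qed.

Lemma face_sym : connect_sym (frel (@face w)).
Proof. exact: fconnect_sym face_inj. Qed.

Definition region (d : D) : D := froot (@face w) d.

Lemma regionP (x y : D) : reflect (region x = region y) (fconnect (@face w) x y).
Proof. exact: (fingraph.rootP face_sym). Qed.

Lemma region_face x : region (face x) = region x.
Proof. exact/esym/regionP/fconnect1. Qed.

Lemma region_opp_tail : region (opp tail) = region tail.
Proof. by rewrite -region_face /face oppK ccw_None. Qed.

Lemma region_opp_head : region (opp head) = region head.
Proof. by rewrite -region_face /face oppK ccw_None // site_head. Qed.

Definition adjacent : rel D :=
  [rel R R' | [exists d : D, (region d == R) && (region (opp d) == R')]].

Lemma connect_adjacent (x : D) : connect adjacent (region tail) (region x).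
Proof.
have /connectP[p pp ->] := connect_turn x.
elim: p (tail) pp => [|z p IH] y /=; first by rewrite connect0.
case/andP => /orP[]/eqP-> /IH; apply: connect_trans; apply: connect1;
  apply/existsP; exists y; rewrite ?eqxx //=.
by rewrite -[y in ccw y](@oppK w) -/(face _) region_face eqxx.
Qed.

Lemma adjacent_crosses (d : D) p : path adjacent (region d) p ->
  last (region d) p = region head ->
  exists s, crosses d s /\ [seq region (opp x) | x <- s] = p.
Proof.
elim: p d => [|R p IH] d /=; first by move=> _ e; exists [::]; split=> //; apply/regionP.
case/andP => /existsP[y /andP[/eqP ey /eqP eR]]; rewrite -eR => pp lp.
have [s [cs es]] := IH (opp y) pp lp.
exists (y :: s); split; last by rewrite /= es.
by rewrite /= cs andbT; apply/regionP.
Qed.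

(** Needed because [least] is unspecified on an empty set. A path without repetition in the
    connected dual graph enters each region at most once. *)
Lemma shortcut_exists : exists s : seq D, shortcut s.
Proof.
have /connectP[p pp lp] := connect_adjacent head.
move: lp; case/shortenP: pp => q pq Uq _ lq.
have [s [cs es]] := adjacent_crosses pq (esym lq).
exists s; rewrite /shortcut cs /= -map_comp.
by move: Uq; rewrite -es.
Qed.

(** * The Alexander numbering of a diagram closed up by a shortcut *)

Section Numbering.
Hypothesis ws : spherical w.
Variable s : seq D.
Hypothesis ss : shortcut s.

Let cs : crosses tail s. Proof. by case/andP: ss. Qed.
Let U : uniq [seq region d | d <- tail :: map (@opp w) s]. Proof. by case/andP: ss. Qed.

(** For each region on the way, the dart after which its boundary meets the incoming arc, and in
    [exit] the outgoing one. The arc starts and stops at endpoints, which the boundary rounds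
    between [opp tail] and [tail], resp. [opp head] and [head]. *)
Let entry : seq D := opp tail :: map (@opp w) s.
Let exit : seq D := rcons s (opp head).

Lemma size_entry : size entry = (size s).+1.
Proof. by rewrite /= size_map. Qed.

Lemma region_entry : map region entry = [seq region d | d <- tail :: map (@opp w) s].
Proof. by rewrite /= region_opp_tail. Qed.

Lemma crosses_regions d s' : crosses d s' ->
  [seq region x | x <- rcons s' (opp head)] = [seq region x | x <- d :: map (@opp w) s'].
Proof.
elim: s' d => [|y s' IH] d /=; first by move/regionP ->; rewrite region_opp_head.
by case/andP => /regionP -> /IH ->.
Qed.

Lemma region_exit : map region exit = map region entry.
Proof. by rewrite region_entry; apply: crosses_regions. Qed.

Lemma uniq_regions : uniq (map region entry).
Proof. by rewrite region_entry. Qed.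

(* How many times the shortcut crosses the edge of [d] from right to left. *)
Definition crossed (d : D) : rat := ((d \in s)%:R - (opp d \in s)%:R)%R.

(** The change of the number along the boundary of a region from [d] to [face d]: the arc cuts the
    region in two, and is met at the edges it crosses and around the endpoints. *)
Definition jump (d : D) : rat :=
  (crossed d - (opp d == tail)%:R + (opp d == head)%:R)%R.

Lemma jumpE d : jump d = ((d \in exit)%:R - (d \in entry)%:R)%R.
Proof.
have Ux : uniq exit by apply: (@map_uniq _ _ region); rewrite region_exit uniq_regions.
have Ue : uniq entry by apply: (@map_uniq _ _ region); rewrite uniq_regions.
have oE (x y : D) : (opp x == y) = (x == opp y).
  by apply/eqP/eqP => [<-|->]; rewrite oppK.
have hs : opp head \notin s by move: Ux; rewrite rcons_uniq => /andP[].
have ts : opp tail \notin map (@opp w) s by move: Ue => /= /andP[].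
rewrite /jump /crossed !oE mem_rcons !inE.
have -> : (d \in map (@opp w) s) = (opp d \in s).
  by rewrite -(mem_map (inv_inj (@oppK w)) s (opp d)) oppK.
have e1 : (((d == opp head) || (d \in s))%:R = (d == opp head)%:R + (d \in s)%:R :> rat)%R.
  by case: eqP => [->|_] /=; rewrite ?(negbTE hs) ?addr0 ?add0r.
have e2 : (((d == opp tail) || (opp d \in s))%:R = (d == opp tail)%:R + (opp d \in s)%:R :> rat)%R.
  have ts' : tail \notin s by rewrite -(mem_map (inv_inj (@oppK w))).
  by case: eqP => [->|_]; rewrite ?add0r // oppK (negbTE ts') addr0.
rewrite e1 e2; ring.
Qed.

Lemma in_region (l : seq D) i d : uniq (map region l) -> i < size l ->
  region d = region (nth tail l i) -> (d \in l) = (d == nth tail l i).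
Proof.
move=> Ul lt e; apply/idP/eqP => [dl|->]; last exact: mem_nth.
have lt' : index d l < size l by rewrite index_mem.
have : nth tail (map region l) (index d l) = nth tail (map region l) i.
  by rewrite !(nth_map tail) // nth_index.
move/eqP; rewrite nth_uniq ?size_map // => /eqP <-.
by rewrite nth_index.
Qed.

Lemma jump_region i d : i <= size s -> region d = region (nth tail entry i) ->
  jump d = ((d == nth tail exit i)%:R - (d == nth tail entry i)%:R)%R.
Proof.
move=> le e.
have lte : i < size entry by rewrite size_entry.
have ltx : i < size exit by rewrite size_rcons.
have ex : region d = region (nth tail exit i).
  by rewrite e -!(nth_map tail tail region) // region_exit.
rewrite jumpE -(in_region _ ltx ex) -?(in_region _ lte e) // ?region_exit;
  exact: uniq_regions.
Qed.

(** The arc leaves each region as often as it enters it, if starting and stopping count as entering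
    and leaving. *)
Lemma jump_orbit x : (\sum_(y | fconnect (@face w) x y) jump y = 0)%R.
Proof.
have sumI (l : seq D) : uniq l ->
    (\sum_(y | fconnect (@face w) x y) (y \in l)%:R = (count (fun y => region y == region x) l)%:R :> rat)%R.
  move=> Ul; rewrite -sum1_count natr_sum big_mkcond /= [RHS]big_mkcond /=.
  rewrite [RHS]big_uniq //= [RHS]big_mkcond /=; apply: eq_bigr => y _.
  have -> : fconnect (@face w) x y = (region y == region x).
    by apply/regionP/eqP => ->.
  by case: (y \in l); case: eqP.
rewrite (eq_bigr (fun y => (y \in exit)%:R - (y \in entry)%:R)%R); last by move=> y _; exact: jumpE.
rewrite sumrB !sumI; first last.
- by apply: (@map_uniq _ _ region); rewrite region_exit uniq_regions.
- by apply: (@map_uniq _ _ region); rewrite uniq_regions.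
have ce l : count (fun y => region y == region x) l = count (pred1 (region x)) (map region l).
  by rewrite count_map.
by rewrite !ce region_exit subrr.
Qed.

Definition outgoing (d : D) : rat := ((~~ d.2)%:R)%R.

(* Up to a constant depending on the crossing, the mean of the Alexander numbers
  of the two regions along the half-strand. *)
Definition phi (d : D) : rat :=
  if site d is Some (x, out) then ((x.2 == out) != x.1.2)%:R%R else 0%R.

Lemma tail_site d x out : site d = Some (x, out) -> (d == tail) = false.
Proof. by move=> e; apply/eqP => h; rewrite h in e. Qed.

Lemma head_site d x out : site d = Some (x, out) -> (d == head) = false.
Proof. by move=> e; apply/eqP => h; rewrite h site_head in e. Qed.

Lemma phi_ccw d : (phi (ccw d) - phi d =
  outgoing (ccw d) + outgoing d - 1 - (d == tail)%:R + (d == head)%:R)%R.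
Proof.
case e: (site d) => [[x out]|].
  rewrite (tail_site e) (head_site e) /outgoing.
  rewrite -(site_out wg e) -(site_out wg (site_ccw e)) /phi e (site_ccw e).
  by case: x {e} => -[n a] l; rewrite /mate /=; case: l; case: a; case: out.
rewrite ccw_None // /outgoing; have th := negbTE (tail_head w).
by case: (site_None e) => ->; rewrite eqxx ?[head == tail]eq_sym th /=; lra.
Qed.

Lemma numbering : exists g : D -> rat,
  [/\ forall d, (g (ccw d) - g d = phi (ccw d) - phi d)%R,
      forall d, (g (opp d) - g d = crossed d)%R
    & forall d, (g (face d) - outgoing (face d) - (g d - outgoing d) = jump d)%R].
Proof.
have [chi chiE] := orbit_cobound face_inj jump_orbit.
pose phi1 d := (phi d - chi d - outgoing d)%R.
pose psi1 d := ((opp d \in s)%:R - chi d - outgoing d)%R.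
have out_opp d : outgoing (opp d) = (1 - outgoing d)%R.
  by rewrite /outgoing /=; case: (d.2).
have hyp d : (phi1 (ccw d) - phi1 d = psi1 (opp d) - psi1 d)%R.
  have := phi_ccw d; have := chiE (opp d); rewrite /face oppK /jump /crossed oppK.
  rewrite /phi1 /psi1 oppK out_opp; lra.
have euler : fcard (@ccw w) D + fcard (@opp w) D + fcard (@face w) D = #|{: D}| + 2.
  have := fcard_involution (@oppK w) (@opp_ne w).
  by have /eqP := ws; lia.
have [h [hf ho]] := sphere_cobound ccw_inj (@oppK w) (fun=> erefl) turn_const euler hyp.
exists (fun d => h d + chi d + outgoing d)%R; split=> d.
- have := hf (opp d); have := ho d; rewrite /face oppK /phi1; lra.
- have := ho d; rewrite hyp /psi1 /crossed oppK; lra.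
- have := chiE d; have := hf d; lra.
Qed.

(** Up to a common shift, [G d] is the number on the right of [d]. It is constant along the boundary
    of a region from just after the entry of the arc to its exit. *)
Lemma shortcut_drop g :
  (forall d, g (opp d) - g d = crossed d)%R ->
  (forall d, (g (face d) - outgoing (face d) - (g d - outgoing d) = jump d)%R) ->
  (`|g head - g tail| <= (size s)%:R)%R.
Proof.
move=> go gf; pose G d := (g d - outgoing d)%R.
have Gf d : (G (face d) = G d + jump d)%R by have := gf d; rewrite /G; lra.
have out_opp d : outgoing (opp d) = (1 - outgoing d)%R.
  by rewrite /outgoing /=; case: (d.2).
pose E i := nth tail entry i; pose T i := nth tail exit i.
have ET i : i <= size s -> region (T i) = region (E i).
  move=> le; rewrite -!(nth_map tail tail region) ?region_exit //.
    by rewrite size_entry.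
  by rewrite size_rcons.
have G_T i : i <= size s -> G (T i) = G (face (E i)).
  move=> le.
  have fT : fconnect (@face w) (face (E i)) (T i).
    by apply/regionP; rewrite region_face ET.
  set e := E i in fT *; set t := T i in fT *.
  have je d : region d = region e -> jump d = ((d == t)%:R - (d == e)%:R)%R.
    exact: jump_region.
  case: (eqVneq t e) => [te|te].
    by rewrite Gf je // te subrr addr0.
  have := iter_findex fT; set n := findex _ _ _ => itn.
  rewrite -itn; suff h k : k <= n -> G (iter k (@face w) (face e)) = G (face e) by apply: h.
  elim: k => [|k IH] //= lt; rewrite Gf IH 1?ltnW //.
  have re : region (iter k (@face w) (face e)) = region e.
    by elim: (k) => [|j IHj] /=; rewrite region_face.
  have ltn := findex_max fT; rewrite -/n in ltn.
  rewrite je //; case: eqP => [e1|_].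
    have := findex_iter (leq_trans lt (ltnW ltn)); rewrite e1 -/n => e2.
    by rewrite e2 ltnn in lt.
  case: eqP => [e1|_]; last by rewrite subrr addr0.
  have e2 : iter k.+1 (@face w) (face e) = iter 0 (@face w) (face e) by rewrite /= e1.
  have := findex_iter (leq_ltn_trans lt ltn); rewrite e2.
  by rewrite findex_iter ?fingraph.order_gt0.
(* The shortcut terms of [go] and [gf] cancel. There remains [2 * outgoing (T i) - 1], the
   difference between the two sides of the strand, corrected to 0 when [T i] is the tail or the
   head. *)
have step i : i < size s -> (`|G (T i.+1) - G (T i)| <= 1)%R.
  move=> lt; rewrite G_T //.
  have eE : E i.+1 = opp (T i).
    by rewrite /E /T /= (nth_map tail) // nth_rcons lt.
  rewrite eE Gf /G out_opp.
  have := go (T i); rewrite /jump oppK /crossed oppK => h.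
  have h2 : (g (opp (T i)) = g (T i) + ((T i \in s)%:R - (opp (T i) \in s)%:R))%R by lra.
  rewrite h2 /outgoing.
  have tl : (T i == tail) -> (T i).2 = false by move/eqP->.
  have hd : (T i == head) -> (T i).2 = true by move/eqP->.
  move: tl hd; case: (T i == tail); case: (T i == head); case: ((T i).2) => /=;
    by move=> tl hd; rewrite ?ler_norml; try (by have := tl isT); try (by have := hd isT); lra.
have total i : i <= size s -> (`|G (T i) - G (T 0)| <= i%:R)%R.
  elim: i => [|i IH] lt; first by rewrite subrr normr0.
  have h1 := IH (ltnW lt); have h2 := step i lt.
  have -> : (G (T i.+1) - G (T 0) = (G (T i.+1) - G (T i)) + (G (T i) - G (T 0)))%R by lra.
  apply: le_trans (ler_normD _ _) _; rewrite -natr1 addrC; exact: lerD.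
have GT0 : G (T 0) = G tail.
  by rewrite G_T // /E /= /face oppK ccw_None.
(* The jump around the head makes up for [outgoing] being 1 at the tail and 0 at the head. *)
have GTk : G head = (G (T (size s)) + 1)%R.
  have e : T (size s) = opp head by rewrite /T nth_rcons ltnn eqxx.
  have fe : face (opp head) = head by rewrite /face oppK ccw_None // site_head.
  rewrite -[in LHS]fe Gf e; congr (_ + _)%R.
  have Ux : uniq (map region exit) by rewrite region_exit uniq_regions.
  have n1 : opp head \notin s.
    by have := map_uniq Ux; rewrite rcons_uniq => /andP[].
  have n2 : head \notin s.
    apply/negP => hs; have lt : size s < size exit by rewrite size_rcons.
    have : region head = region (T (size s)) by rewrite e region_opp_head.
    move/(in_region Ux lt); rewrite mem_rcons inE hs orbT => /esym/eqP h.
    by have := opp_ne head; rewrite -e /T -h eqxx.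
  rewrite /jump /crossed oppK (negbTE n1) (negbTE n2) eqxx [head == tail]eq_sym.
  by rewrite (negbTE (tail_head w)) /=; lra.
have := total _ (leqnn _); rewrite GT0.
have -> : (G (T (size s)) - G tail = g head - g tail)%R.
  have -> : G (T (size s)) = (G head - 1)%R by lra.
  by rewrite /G /outgoing /=; lra.
by [].
Qed.

End Numbering.
End Planar.

(** * The long component *)

Section LongComponent.
Variables (w : gcode) (S : {fset crossing}).
Hypothesis wg : gauss w.
Notation D := (dart w).
Notation tail := (tail_dart w).
Notation head := (head_dart w).
Notation adv := (advance (w := w) S).

Lemma phi_smooth (d : D) :
  (phi (smooth S d) - phi d = - (cusp_weight S d)%:~R)%R.
Proof.
case e: (site d) => [[x out]|]; last first.
  by rewrite smooth_None // /cusp_weight e subrr oppr0.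
rewrite /phi e (site_smooth wg S e) /cusp_weight e /=.
case: (oriented S x.1) => /=.
  by case: x {e} => -[n a] l /=; case: l; case: a; case: out; rewrite subrr oppr0.
by case: x {e} => -[n a] l /=; case: l; case: a; case: out.
Qed.

(** [g - phi] is constant around a crossing, so [g] varies like [phi] between any two half-strands
    there, not only between consecutive ones. *)
Lemma smooth_numbering (g : D -> rat) :
  (forall d, g (ccw d) - g d = phi (ccw d) - phi d)%R ->
  forall d, (g (smooth S d) - g d = - (cusp_weight S d)%:~R)%R.
Proof.
move=> gc d; rewrite -phi_smooth.
pose u d := (g d - phi d)%R.
have uc x : u (ccw x) = u x by have := gc x; rewrite /u; lra.
suff : u (smooth S d) = u d by rewrite /u; lra.
case e: (site d) => [[x out]|]; last by rewrite smooth_None.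
have [xw <-] := site_inv wg e.
have flip b : u (dart_at w x (~~ b)) = u (dart_at w x b).
  by rewrite -(ccw2_dart_at wg) // !uc.
have flip' b : u (dart_at w (mate x) (~~ b)) = u (dart_at w (mate x) b).
  by rewrite -(ccw2_dart_at wg) ?mate_in // !uc.
have base : u (dart_at w (mate x) out) = u (dart_at w x out).
  have := ccw_dart_at out xw; case: ifP => _ ec; first by rewrite -ec uc.
  by rewrite -flip' -ec uc.
by rewrite /smooth site_dart_at //; case: ifP => _; rewrite ?flip' base.
Qed.

Lemma walk_back (x y : D) : y = opp x -> adv (opp (adv x)) = y.
Proof. by move=> ->; rewrite /advance oppK (smoothK wg). Qed.

Lemma advance_inj : injective adv.
Proof. exact: inj_comp (inv_inj (smoothK wg S)) (inv_inj (@oppK w)). Qed.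

(** A path meeting its own reversal would turn back midway. Peeling off one step at both ends
    reduces the gap to 0 or 1, where [opp] or [smooth] would fix a half-strand. *)
Lemma long_path_simple n :
  (forall i, 0 < i <= n -> smooth S (iter i adv tail) != iter i adv tail) ->
  forall i j, i <= n -> j <= n -> iter j adv tail != opp (iter i adv tail).
Proof.
move=> fixed.
have half k i : i + k <= n -> iter (i + k) adv tail != opp (iter i adv tail).
  elim/ltn_ind: k i => -[|[|k]] IH i le.
  - by rewrite addn0 eq_sym opp_ne.
  - rewrite addn1 in le *; apply/eqP => e.
    by have /eqP[] := fixed i.+1 le; rewrite {1}e.
  - have lt : i.+1 + k <= n by lia.
    have := IH k _ i.+1 lt; rewrite ltnS leqnSn => /(_ isT) ne.
    apply/eqP => e; case/eqP: ne; apply: advance_inj.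
    have back : adv (opp (iter i.+1 adv tail)) = opp (iter i adv tail) by exact: walk_back.
    by rewrite back -e (_ : i + k.+2 = (i.+1 + k).+1) //; lia.
move=> i j le le'; case: (leqP i j) => h.
  by have := half (j - i) i; rewrite subnKC //; apply.
have := half (i - j) j; rewrite subnKC ?(ltnW h) // => /(_ le).
by apply: contraNneq => ->; rewrite oppK.
Qed.

Lemma long_bound (s : seq D) : spherical w -> shortcut s ->
  half_surviving (long_cusps w S) <= size s.
Proof.
move=> ws ss.
have names : undup (map fst w) =i crossings w.
  by move=> c; rewrite mem_undup; apply/mapP/imfsetP => /= -[p pu ->]; exists p.
have [n [en fixed lt sz _]] := long_path S wg (undup_uniq _) names.
have [g [gc go gf]] := numbering wg ws ss.
have drop := shortcut_drop wg ss go gf.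
have gs := smooth_numbering gc.
pose X := traject adv tail n.+1.
have UX : uniq X.
  rewrite /X -(take_traject _ _ (ltnW lt)) take_uniq //; exact: orbit_uniq.
have XP x : x \in X -> exists2 i, i <= n & x = iter i adv tail.
  by move/trajectP => [i li ->]; exists i.
(* No edge is travelled twice, in whichever direction, so each crossing of the shortcut is met at
   most once. *)
have UXX : uniq (X ++ map (@opp w) X).
  rewrite cat_uniq UX (map_inj_uniq (inv_inj (@oppK w))) UX andbT andTb.
  apply/hasPn => y /mapP[x /XP[i li ->] ->]; apply/negP => /XP[j lj e].
  by have := long_path_simple fixed li lj; rewrite e eqxx.
have cnt : (\sum_(i < n.+1) `|crossed s (iter i adv tail)| <= (size s)%:R :> rat)%R.
  rewrite -(sum_traject adv (fun x => `|crossed s x|)%R).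
  apply: (@le_trans _ _ (\sum_(x <- X) ((x \in s)%:R + (opp x \in s)%:R))%R).
    apply: ler_sum => x _; rewrite /crossed.
    by case: (x \in s); case: (opp x \in s); rewrite ?subrr ?subr0 ?sub0r ?normrN ?normr0 ?normr1 //; lra.
  rewrite big_split /=.
  have -> : (\sum_(x <- X) (opp x \in s)%:R = \sum_(x <- map (@opp w) X) (x \in s)%:R :> rat)%R.
    by rewrite big_map.
  rewrite -big_cat /= -natr_sum ler_nat.
  have -> : \sum_(x <- X ++ map (@opp w) X) (x \in s) = count (mem s) (X ++ map (@opp w) X).
    by rewrite -sum1_count [RHS]big_mkcond /=; apply: eq_bigr => x _; case: (x \in s).
  rewrite -size_filter; apply: uniq_leq_size; first exact: filter_uniq.
  by move=> x; rewrite mem_filter => /andP[].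
have tele : (\sum_(i < n.+1) (crossed s (iter i adv tail) -
      (cusp_weight S (opp (iter i adv tail)))%:~R) = g head - g tail)%R.
  rewrite -en; elim: (n.+1) => [|k IH]; first by rewrite big_ord0 subrr.
  rewrite big_ord_recr /= IH.
  have := go (iter k adv tail); have := gs (opp (iter k adv tail)).
  by rewrite -/(adv _); lra.
move: tele; rewrite sumrB => tele.
have sumle : (`|\sum_(i < n.+1) crossed s (iter i adv tail)| <= (size s)%:R :> rat)%R.
  exact: le_trans (ler_norm_sum _ _ _) cnt.
set W := (\sum_(i < n.+1) cusp_weight S (opp (iter i adv tail)))%R in sz.
have Wz : (\sum_(i < n.+1) (cusp_weight S (opp (iter i adv tail)))%:~R = W%:~R :> rat)%R.
  by rewrite /W rmorph_sum.
rewrite Wz in tele.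
have : (`|W%:~R| <= (size s)%:R + (size s)%:R :> rat)%R.
  have -> : (W%:~R = \sum_(i < n.+1) crossed s (iter i adv tail) - (g head - g tail) :> rat)%R by lra.
  exact: le_trans (ler_normB _ _) (lerD sumle drop).
rewrite -intr_norm -natrD pmulrn ler_int.
rewrite /half_surviving sz => le.
have le2 : `|W|%N <= size s + size s by lia.
by rewrite leq_half_double -addnn; lia.
Qed.

End LongComponent.

Lemma leastP (P : nat -> Prop) : (exists n, P n) -> P (least P).
Proof.
case=> n Pn.
suff [m Pm] : exists m, P m /\ forall k, P k -> m <= k.
  by have [] := epsilon_spec (inhabits 0) (fun n => P n /\ forall k, P k -> n <= k)
    (ex_intro _ m Pm).
elim/ltn_ind: n Pn => n IH Pn.
case: (classic (exists2 k, k < n & P k)) => [[k lt Pk]|no]; first exact: IH lt Pk.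
exists n; split=> // k Pk; rewrite leqNgt; apply/negP => lt; by apply: no; exists k.
Qed.

Lemma diagram_bound (D : diagram) :
  Lambda_degree (arrow_polynomial D) <= diagram_height D.
Proof.
have [s0 ss0] := shortcut_exists (code_gauss D).
have [s [ss sz]] : exists s : seq (dart D), shortcut s /\ size s = diagram_height D.
  by apply: (@leastP (fun k => exists s : seq (dart D), shortcut s /\ size s = k)); exists (size s0), s0.
apply: arrow_Lambda_bounded => S; rewrite -sz.
by apply: (long_bound S (code_gauss D)) => //; apply: code_spherical.
Qed.

Theorem theorem5p4 (K : knotoid) (D : diagram) (DK : K D) :
  Lambda_degree (arrow_polynomial D) <= knotoid_height K.
Proof.
have [D' [KD' hD']] : exists D' : diagram, K D' /\ diagram_height D' = knotoid_height K.
  by apply: (@leastP (fun k => exists D' : diagram, K D' /\ diagram_height D' = k));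
    exists (diagram_height D), D.
have [D0 KE] := knotoid_class K.
have e : equivalent D D'.
  have e1 := proj1 (KE D) DK; have e2 := proj1 (KE D') KD'.
  exact: rst_trans (rst_sym _ _ _ _ e1) e2.
rewrite (Lambda_degree_equivalent e) -hD'; exact: diagram_bound.
Qed.
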